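(* There is a polynomial-time algorithm that, given a finite set $\mathcal{C}$ of alternatives, an alternative $c\in\mathcal{C}$ and a profile $P_{poset}$ of partial orders on $\mathcal{C}$, checks whether or not $c$ is a possible co-winner for $P_{poset}$ with respect to plurality with runoff.
   Context: Let $\mathcal{C}$ be a finite set of $m$ alternatives; $m$ is part of the input and not bounded, and votes are unweighted. A (complete) profile is a finite list $P=(V_1,\dots,V_n)$ of linear orders on $\mathcal{C}$. A voting rule $r$ maps each profile to a nonempty subset of $\mathcal{C}$ (the winners). A partial order is a reflexive, transitive, antisymmetric relation; a linear order $V$ extends a partial order $O$ if $O\subseteq V$. A profile $P=(V_1,\dots,V_n)$ of linear orders extends a profile $P_{poset}=(O_1,\dots,O_n)$ of partial orders if each $V_i$ extends $O_i$. An alternative $c$ is a possible co-winner for $P_{poset}$ with respect to $r$ if there is an extension $P$ of $P_{poset}$ with $c\in r(P)$. Plurality with runoff has two steps. In the first step, all alternatives are eliminated except the two that are ranked in the top position most often; in the second step (the runoff), the one of these two that is preferred to the other by a majority of the votes wins. Parallel-universes tie-breaking is used: an alternative is a winner if and only if there exists a way to break ties in both steps (the choice of the two alternatives entering the runoff, and the runoff itself) such that it wins. *)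

(* Defs.v *)
From mathcomp Require Import all_boot.
Set Implicit Arguments.
Unset Strict Implicit.
Unset Printing Implicit Defensive.

(* In an order O or a vote V, [O x y] reads "x is ranked at least as high
   as y". *)

Record poset (C : finType) : Type := Poset {
  poset_rel :> rel C;
  poset_refl : reflexive poset_rel;
  poset_anti : antisymmetric poset_rel;
  poset_trans : transitive poset_rel }.

Record vote (C : finType) : Type := Vote {
  vote_poset :> poset C;
  vote_total : total vote_poset }.

Definition profile (C : finType) (n : nat) : Type := 'I_n -> vote C.
Definition poset_profile (C : finType) (n : nat) : Type := 'I_n -> poset C.

Definition extends (C : finType) (V : vote C) (O : poset C) : Prop :=
  subrel O V.

Definition profile_extends (C : finType) (n : nat)
    (P : profile C n) (Q : poset_profile C n) : Prop :=
  forall i, extends (P i) (Q i).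

Definition voting_rule : Type :=
  forall (C : finType) (n : nat), profile C n -> {set C}.

Definition possible_cowinner (r : voting_rule) (C : finType) (n : nat)
    (Q : poset_profile C n) (c : C) : Prop :=
  exists2 P : profile C n, profile_extends P Q & c \in r C n P.

Section PluralityWithRunoff.
Variables (C : finType) (n : nat) (P : profile C n).

Definition plurality_score (x : C) : nat :=
  #|[set i : 'I_n | [forall y, P i x y]]|.

(* For x != y, the number of votes that prefer x to y. *)
Definition support (x y : C) : nat := #|[set i : 'I_n | P i x y]|.

(* S may be the set of alternatives entering the runoff, for some way of
   breaking ties in the first step. If there is only one alternative, it enters
   the runoff alone. *)
Definition finalists (S : {set C}) : bool :=
  (#|S| == minn 2 #|C|) &&
  [forall x in S, forall y in ~: S, plurality_score y <= plurality_score x].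

(* x wins the runoff among S, for some way of breaking a tie there. *)
Definition wins_runoff (S : {set C}) (x : C) : bool :=
  (x \in S) && [forall y in S, support y x <= support x y].

Definition plurality_runoff_winners : {set C} :=
  [set x | [exists S : {set C}, finalists S && wins_runoff S x]].

End PluralityWithRunoff.

Definition plurality_runoff : voting_rule := plurality_runoff_winners.

Lemma plurality_runoff_nonempty (C : finType) (n : nat) (P : profile C n) :
  0 < #|C| -> plurality_runoff P != set0.
Proof.
move=> C0.
suff [S Sfin [x Sx]] : exists2 S, finalists P S & exists x, wins_runoff P S x.
  by apply/set0Pn; exists x; rewrite inE; apply/existsP; exists S; rewrite Sfin.
have /card_gt0P[x0 _] := C0.
case: (@arg_maxnP _ x0 predT (plurality_score P) isT) => x _ xmax.
case: (pickP [pred y | y != x]) => [y0 /= y0x|Cx].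
- case: (@arg_maxnP _ y0 [pred y | y != x] (plurality_score P) y0x) => y /= yx ymax.
  exists [set x; y].
    apply/andP; split.
      have := subset_leq_card (subsetT [set x; y]).
      by rewrite cardsT cards2 eq_sym yx => /minn_idPl->.
    apply/forall_inP => u /set2P uxy; apply/forall_inP => v.
    rewrite !inE negb_or => /andP[vx _]; case: uxy => ->.
      exact: xmax.
    exact: ymax.
  case/orP: (leq_total (support P y x) (support P x y)) => h.
    exists x; rewrite /wins_runoff set21; apply/forall_inP => z.
    by case/set2P=> ->.
  exists y; rewrite /wins_runoff set22; apply/forall_inP => z.
  by case/set2P=> ->.
- have eqx z : z = x by apply/eqP; have /negbFE := Cx z.
  have setTx : [set: C] = [set x] by apply/setP=> z; rewrite !inE (eqx z) eqxx.
  exists [set: C].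
    rewrite /finalists -cardsT setTx cards1 eqxx /=.
    by apply/forall_inP => u _; apply/forall_inP => v; rewrite (eqx v) (eqx u).
  exists x; rewrite /wins_runoff inE; apply/forall_inP => z _.
  by rewrite (eqx z).
Qed.

(* Random access machine with structured control: the memory consists of
   countably many cells holding natural numbers, addressed directly or
   indirectly. Addition and truncated subtraction are the only arithmetic
   operations, so that in t steps the bit lengths of the stored numbers grow by
   O(t) only; hence counting steps as below is polynomially equivalent to time
   on Turing machines. *)

Inductive expr : Type :=
  | Const of nat
  | Read of expr
  | Add of expr & expr
  | Sub of expr & expr.

Inductive prog : Type :=
  | Skip
  | Write of expr & expr
  | Seq of prog & prog
  | If of expr & prog & prog
  | While of expr & prog.

Definition memory : Type := nat -> nat.

Fixpoint eval (M : memory) (e : expr) : nat :=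
  match e with
  | Const k => k
  | Read e1 => M (eval M e1)
  | Add e1 e2 => eval M e1 + eval M e2
  | Sub e1 e2 => eval M e1 - eval M e2
  end.

Fixpoint expr_cost (e : expr) : nat :=
  match e with
  | Const _ => 1
  | Read e1 => (expr_cost e1).+1
  | Add e1 e2 | Sub e1 e2 => (expr_cost e1 + expr_cost e2).+1
  end.

Definition update (M : memory) (a v : nat) : memory :=
  fun b => if b == a then v else M b.

(* [exec p M t M']: started in memory M, the program p halts after t steps in
   memory M'. Tests succeed on nonzero values. *)
Inductive exec : prog -> memory -> nat -> memory -> Prop :=
  | ExecSkip M : exec Skip M 1 M
  | ExecWrite M a e :
      exec (Write a e) M (expr_cost a + expr_cost e).+1
           (update M (eval M a) (eval M e))
  | ExecSeq p q M1 M2 M3 t u :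
      exec p M1 t M2 -> exec q M2 u M3 -> exec (Seq p q) M1 (t + u).+1 M3
  | ExecIfTrue e p q M M' t :
      eval M e != 0 -> exec p M t M' -> exec (If e p q) M (expr_cost e + t).+1 M'
  | ExecIfFalse e p q M M' t :
      eval M e = 0 -> exec q M t M' -> exec (If e p q) M (expr_cost e + t).+1 M'
  | ExecWhileDone e p M :
      eval M e = 0 -> exec (While e p) M (expr_cost e).+1 M
  | ExecWhileStep e p M1 M2 M3 t u :
      eval M1 e != 0 -> exec p M1 t M2 -> exec (While e p) M2 u M3 ->
      exec (While e p) M1 (expr_cost e + t + u).+1 M3.

(* Cell 0 holds the length of the input word, cell i + 1 its i-th bit, and all
   other cells hold 0. *)
Definition input_memory (w : seq bool) : memory :=
  fun a => if a is i.+1 then nth false w i : nat else size w.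

(* The answer is left in cell 0: 1 for yes, 0 for no. *)
Definition polytime_decidable (I : Type) (encode : I -> seq bool)
    (L : I -> Prop) : Prop :=
  exists (p : prog) (a k : nat), forall x : I,
    exists (t : nat) (M : memory) (answer : bool),
      [/\ exec p (input_memory (encode x)) t M,
          t <= a * size (encode x) ^ k + a,
          M 0 = nat_of_bool answer
        & answer <-> L x].

Record instance : Type := Instance {
  alternatives : finType;
  candidate : alternatives;
  voters : nat;
  posets : poset_profile alternatives voters }.
Arguments posets : clear implicits.

Definition unary (k : nat) : seq bool := rcons (nseq k true) false.

Definition poset_bits (C : finType) (O : poset C) : seq bool :=
  [seq O x y | x <- enum C, y <- enum C].

(* Alternatives are numbered along [enum], and each partial order is given by
   its m x m incidence matrix, row by row. Unary notation for the number of
   alternatives, the position of the candidate and the number of voters does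
   not matter up to polynomial factors, as alternatives and votes are listed
   individually in the input anyway. *)
Definition encode_instance (I : instance) : seq bool :=
  unary #|alternatives I| ++ unary (enum_rank (candidate I)) ++
  unary (voters I) ++
  flatten [seq poset_bits (posets I i) | i <- enum 'I_(voters I)].

(* Main.v *)
Require Import Defs.
From mathcomp Require Import all_boot.
From mathcomp Require Import zify.
Set Implicit Arguments.
Unset Strict Implicit.
Unset Printing Implicit Defensive.

(* Fix the rival d entering the runoff with c. Only the top t_i of each vote and
   the order of c and d in it matter: t_i may be any maximal element of O_i, and
   the vote can rank c above d unless O_i ranks d above c or t_i = d. Voters who
   rank d above c anyway may as well put d on top when d is maximal, and the
   other voters with c maximal may as well choose between c and d. It remains to
   guess a bound T on the scores of the other alternatives and the numbers k2, k3
   of tops given to d by voters who can, respectively cannot, put c on top, and to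
   place the remaining voters under capacities: a bipartite flow problem, solved
   by push-relabel. The algorithm is written in a small language whose loops all
   run once through 0, ..., L - 1 with L the input length, so its compilation to
   the machine takes polynomial time whatever the program is. *)

(** * Linear extensions and tops *)

(** Once [k2] and [k3] are fixed, the scores of both finalists no longer depend on who is chosen:
    [c] gets all voters who can put it on top except [k2], and [d] gets its free voters plus
    [k2 + k3]. Hence the other alternatives need upper bounds only, and what remains is a flow
    problem without lower bounds. Push-relabel suits it better than augmenting paths because a step
    inspects two arrays locally and needs no graph search. Its labels are known to stay below m only
    if the instance is feasible; this suffices, since the loop runs for a fixed number of steps and
    the answer is read off from whether an overload is left. Fixed iteration counts also make the
    time bound a function of the program text, so that the correctness proof of the algorithm never
    mentions time. *)

Section LinearExtension.
Variable C : finType.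
Implicit Types O : poset C.

(** Everything at or above [x] is placed over everything at or below [y]; a new cycle would put [y]
    above [x] already in [O]. *)
Lemma poset_add O x y :
  ~~ O y x -> exists2 O' : poset C, subrel O O' & O' x y.
Proof.
move=> nyx; pose r a b := O a b || O a x && O y b.
have tr := @poset_trans C O.
have r_refl : reflexive r by move=> a; rewrite /r poset_refl.
have r_anti : antisymmetric r.
  move=> a b /andP[/orP[ab|/andP[ax yb]] /orP[ba|/andP[bx ya]]].
  - by apply: (@poset_anti C O); rewrite ab.
  - by case/negP: nyx; apply: tr ya (tr _ _ _ ab bx).
  - by case/negP: nyx; apply: tr yb (tr _ _ _ ba ax).
  - by case/negP: nyx; apply: tr ya ax.
have r_trans : transitive r.
  move=> b a e /orP[ab|/andP[ax yb]] /orP[be|/andP[bx ye]]; apply/orP.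
  - by left; apply: tr ab be.
  - by right; rewrite ye (tr _ _ _ ab bx).
  - by right; rewrite ax (tr _ _ _ yb be).
  - by right; rewrite ax ye.
exists (Poset r_refl r_anti r_trans) => /= [a b ab|]; rewrite /r ?ab //.
by rewrite !poset_refl orbT.
Qed.

Lemma linear_extension O : exists V : vote C, extends V O.
Proof.
have [k] := ubnP #|[set p | ~~ O p.1 p.2]|; elim: k O => // k IHk O.
rewrite ltnS => leOk.
have [totO|] := boolP [forall x, forall y, O x y || O y x].
  have tO : total O by move=> x y; apply: (forallP (forallP totO x) y).
  by exists (Vote tO).
rewrite negb_forall => /existsP[x]; rewrite negb_forall => /existsP[y].
rewrite negb_or => /andP[nxy nyx].
have [O' OO' xy'] := poset_add nyx.
have [|V O'V] := IHk O'; last by exists V => a b /OO'; apply: O'V.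
apply: leq_trans leOk; apply: proper_card; apply/properP; split.
  by apply/subsetP => p; rewrite !inE; apply: contra; apply: OO'.
by exists (x, y); rewrite !inE /= ?xy'.
Qed.

Definition maximal O x := [forall y, O y x ==> (y == x)].

Lemma maximalP O x : reflect (forall y, O y x -> y = x) (maximal O x).
Proof. by apply: (iffP forall_inP) => h y /h /eqP. Qed.

Lemma poset_add_top O x :
  maximal O x ->
  exists2 O' : poset C, subrel O O' &
    (forall y, O' x y) /\ (forall a b, O' a b -> O a b || (a == x)).
Proof.
move/maximalP=> xmax; pose r a b := O a b || (a == x).
have r_refl : reflexive r by move=> a; rewrite /r poset_refl.
have r_anti : antisymmetric r.
  move=> a b /andP[/orP[ab|/eqP ->] /orP[ba|/eqP bx]] //.
  - by apply: (@poset_anti C O); rewrite ab.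
  - by rewrite bx; apply: xmax; rewrite -bx.
  - by apply/esym/xmax.
have r_trans : transitive r.
  move=> b a e /orP[ab|/eqP ->] /orP[be|/eqP bx]; rewrite /r ?eqxx ?orbT //.
    by rewrite (@poset_trans C O _ _ _ ab be).
  by move: ab; rewrite bx => /xmax ->; rewrite eqxx orbT.
exists (Poset r_refl r_anti r_trans) => /= [a b ab|]; first by rewrite /r ab.
by split=> // y; rewrite /r eqxx orbT.
Qed.

(** Putting [t] on top only creates pairs whose first member is [t]. So if [d] is above [c]
    afterwards, it was so in [O] or [d] is [t]; otherwise [c] can still be placed above [d]. *)
Lemma extension_with_top O t c d :
  maximal O t ->
  exists V : vote C,
    [/\ extends V O, forall y, V t y & ~~ (O d c || (t == d)) -> V c d].
Proof.
move=> /poset_add_top[O1 OO1 [O1t O1sub]].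
have [dc|ndc] := boolP (O1 d c).
  have [V O1V] := linear_extension O1; exists V; split.
  - by move=> a b /OO1; apply: O1V.
  - by move=> y; apply: O1V.
  - by move: (O1sub _ _ dc); rewrite (eq_sym d) => ->.
have [O2 O12 cd2] := poset_add ndc; have [V O2V] := linear_extension O2.
exists V; split; last by move=> _; apply: O2V.
- by move=> a b /OO1 /O12; apply: O2V.
- by move=> y; apply/O2V/O12.
Qed.

(** An alternative with a largest lower set is on top, as one above it would have a strictly larger
    lower set. *)
Lemma vote_top (V : vote C) (x0 : C) : exists t, forall y, V t y.
Proof.
case: (@arg_maxnP _ x0 predT (fun x => #|[set y | V x y]|) isT) => t _ tmax.
exists t => y; apply: contraT => nty.
have Vyt : V y t by case/orP: (@vote_total _ V t y) => //; rewrite (negbTE nty).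
have: [set z | V t z] \proper [set z | V y z].
  apply/properP; split.
    by apply/subsetP => z; rewrite !inE; apply: (@poset_trans _ V).
  by exists y; rewrite inE // poset_refl.
by move/proper_card; rewrite ltnNge => /negP[]; apply: tmax.
Qed.

End LinearExtension.

(** * Possible co-winners in terms of the tops of the votes *)

Section Cowinner.
Variables (C : finType) (n : nat) (Q : poset_profile C n) (c : C).

Definition top_score (t : 'I_n -> C) (x : C) := #|[set i | t i == x]|.

(* The voters with top d, or with d above c in their partial order, are those
   for whom d beats c in every completion; all others may be completed with c
   above d. *)
Definition tops_elect (d : C) (t : 'I_n -> C) : Prop :=
  [/\ forall i, maximal (Q i) (t i),
      forall y, y != c -> y != d -> top_score t y <= top_score t c,
      forall y, y != c -> y != d -> top_score t y <= top_score t d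
    & (#|[set i | Q i d c || (t i == d)]|).*2 <= n].

Lemma top_scoreE (P : profile C n) (t : 'I_n -> C) x :
  (forall i y, P i (t i) y) -> plurality_score P x = top_score t x.
Proof.
move=> tP; congr #|pred_of_set _|; apply/setP=> i; rewrite !inE.
apply/forallP/eqP => [xP|<- //].
by apply: (@poset_anti _ (P i)); rewrite tP xP.
Qed.

Lemma supportC (P : profile C n) x y :
  x != y -> Defs.support P x y + Defs.support P y x = n.
Proof.
move=> nxy; have := cardsC [set i | P i x y]; rewrite card_ord => cn.
rewrite -[RHS]cn; congr (_ + _); congr #|pred_of_set _|; apply/setP=> i; rewrite !inE.
apply/idP/idP => [yx|]; last first.
  by case/orP: (@vote_total _ (P i) x y) => ->.
apply: contra nxy => xy; apply/eqP.
by apply: (@poset_anti _ (P i)); rewrite xy.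
Qed.

(** In one direction the tops are read off from the votes. In the other, each vote is completed with
    [c] above [d] whenever possible, which helps [c] in the runoff and leaves the tops unchanged. A
    single alternative is a separate case because it enters the runoff without a rival. *)
Lemma possible_cowinner_tops :
  possible_cowinner plurality_runoff Q c <->
  #|C| = 1 \/ exists2 d, d != c & exists t, tops_elect d t.
Proof.
split=> [[P PQ]|].
  rewrite inE => /existsP[S /andP[/andP[/eqP cardS /forall_inP finS]]].
  case/andP=> cS /forall_inP winc.
  have C0 : 0 < #|C| by apply/card_gt0P; exists c.
  have [C1|C2] : #|C| = 1 \/ 1 < #|C| by lia.
    by left.
  right; have : #|S| == 2 by rewrite cardS; lia.
  case/cards2P=> a [b [nab defS]].
  have [d dc {a b nab}defS] : exists2 d, d != c & S = [set c; d].
    move: cS; rewrite defS => /set2P[] ->; first by exists b; rewrite 1?eq_sym.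
    by exists a; rewrite // setUC.
  exists d => //.
  have [t tP] := fin_all_exists (fun i => vote_top (P i) c).
  have out y : y != c -> y != d -> y \in ~: S.
    by move=> yc yd; rewrite defS !inE negb_or yc.
  have [cS' dS] : c \in S /\ d \in S by rewrite defS set21 set22.
  exists t; split.
  - move=> i; apply/maximalP => y /PQ yt.
    by apply: (@poset_anti _ (P i)); rewrite yt tP.
  - move=> y yc yd; rewrite -!(@top_scoreE P) //.
    by have /forall_inP := finS c cS'; apply; apply: out.
  - move=> y yc yd; rewrite -!(@top_scoreE P) //.
    by have /forall_inP := finS d dS; apply; apply: out.
  - have := winc d dS; have := supportC P dc.
    have : #|[set i | Q i d c || (t i == d)]| <= Defs.support P d c.
      apply: subset_leq_card; apply/subsetP => i; rewrite !inE.
      by case/orP=> [/PQ //|/eqP <-]; apply: tP.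
    by lia.
case=> [C1|[d dc [t [tmax tc td half]]]].
  have [P PQ] := fin_all_exists (fun i => linear_extension (Q i)).
  exists P => //; rewrite inE; apply/existsP; exists [set c].
  have eqc x : x = c.
    have /fintype1P[z hz] := introT eqP C1.
    by rewrite (hz x) (hz c).
  rewrite /finalists /wins_runoff C1 cards1 eqxx set11 /=.
  apply/andP; split; apply/forall_inP=> x _; last by rewrite (eqc x).
  by apply/forall_inP=> y _; rewrite (eqc x) (eqc y).
have [P PP] := fin_all_exists (fun i => extension_with_top c d (tmax i)).
have tP i : forall y, P i (t i) y by case: (PP i).
exists P; first by move=> i; case: (PP i).
rewrite inE; apply/existsP; exists [set c; d].
rewrite /finalists /wins_runoff set21 /=.
have -> : #|[set c; d]| == minn 2 #|C|.
  have := subset_leq_card (subsetT [set c; d]).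
  by rewrite cardsT cards2 eq_sym dc => /minn_idPl->.
apply/andP; split; last first.
  apply/forall_inP => x /set2P[-> //|->].
  have : #|[set i | ~~ (Q i d c || (t i == d))]| <= Defs.support P c d.
    apply: subset_leq_card; apply/subsetP => i; rewrite !inE.
    by case: (PP i).
  have := cardsC [set i | Q i d c || (t i == d)].
  have -> : ~: [set i | Q i d c || (t i == d)] =
            [set i | ~~ (Q i d c || (t i == d))].
    by apply/setP=> i; rewrite !inE.
  rewrite card_ord; have := supportC P dc.
  by lia.
apply/forall_inP => x xcd; apply/forall_inP => y.
rewrite !inE negb_or => /andP[yc yd].
rewrite !(@top_scoreE P t) //.
by case/set2P: xcd => ->; auto.
Qed.

End Cowinner.

Lemma subset_of_card (T : finType) (A B : {set T}) k :
  A \subset B -> #|A| <= k <= #|B| ->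
  exists X : {set T}, [/\ A \subset X, X \subset B & #|X| = k].
Proof.
move=> AB; elim: k => [|k IHk] /andP[Ak kB].
  by exists A; split=> //; lia.
have [Ak'|] := leqP #|A| k; last by exists A; split=> //; lia.
have [|X [AX XB cX]] := IHk; first by rewrite Ak' ltnW.
have /properP[_ [x xB nxX]] : X \proper B by rewrite properEcard XB cX.
exists (x |: X); split.
- exact: subset_trans AX (subsetUr _ _).
- by rewrite subUset sub1set xB.
- by rewrite cardsU1 nxX cX.
Qed.

(** * Reduction to counts and a placement under capacities *)

Section Slots.
Variables (C : finType) (n : nat) (Q : poset_profile C n) (c d : C).

Definition above := [set i | Q i d c].
Definition above_max := [set i | Q i d c && maximal (Q i) d].
Definition c_max := [set i | maximal (Q i) c].
Definition both_max := [set i | maximal (Q i) c && maximal (Q i) d].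
Definition swing :=
  [set i | [&& ~~ maximal (Q i) c, ~~ Q i d c & maximal (Q i) d]].
(** The tops of all other voters are settled between [c] and [d]: those in [c_max] take one of the
    two, and those in [above_max] take [d], which costs nothing since they count for [d] in the
    runoff anyway. *)
Definition active :=
  [set i | ~~ maximal (Q i) c && ~~ (Q i d c && maximal (Q i) d)].

(* T bounds the scores of the alternatives other than c and d; k2 and k3 are
   the numbers of tops given to d at the expense of the runoff, by voters who
   could put c on top, respectively could not. *)
Definition slots (T k2 k3 : nat) : Prop :=
  [/\ (#|above| + k2 + k3).*2 <= n, k2 <= #|both_max|, k3 <= #|swing|,
      T + k2 <= #|c_max| & T <= #|above_max| + k2 + k3].

Definition placement (T k3 : nat) (g : 'I_n -> C) : Prop :=
  [/\ forall i, i \in active -> maximal (Q i) (g i),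
      #|[set i in active | g i == d]| <= k3
    & forall y, y != c -> y != d -> #|[set i in active | g i == y]| <= T].

(** Only the sizes of the groups matter, so the [k2] voters of [both_max] who give their top to [d]
    may be chosen freely. Moving further swing voters to [d] until there are [k3] of them can only
    lower the scores of the other alternatives. *)
Lemma tops_elect_slots :
  d != c ->
  (exists t, tops_elect Q c d t) <->
  (exists T k2 k3, slots T k2 k3 /\ exists g, placement T k3 g).
Proof.
move=> dc.
have max_d_nc i : maximal (Q i) c -> Q i d c = false.
  by move/maximalP=> cmax; apply: contraNF dc => /cmax ->.
split=> [[t [tmax tc td half]]|[T [k2 [k3 [[half k2b k3s Tc Td] [g [gmax gd gT]]]]]]].
  pose k2 := #|[set i in both_max | t i == d]|.
  pose k3 := #|[set i in swing | t i == d]|.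
  (* The smaller score of the two finalists bounds every other score and is reached by both, which
     is all that [T] is used for. *)
  exists (minn (top_score t c) (top_score t d)), k2, k3; split.
    split.
    (* The three groups are disjoint, and each of their voters counts for [d] in the runoff. *)
    - apply: leq_trans half; rewrite leq_double /k2 /k3 -cardsUI.
      have -> : above :&: [set i in both_max | t i == d] = set0.
        apply/setP=> i; rewrite !inE; case mc: (maximal (Q i) c); rewrite ?andbF //.
        by rewrite max_d_nc.
      rewrite cards0 addn0 -cardsUI.
      have -> : (above :|: [set i in both_max | t i == d]) :&:
          [set i in swing | t i == d] = set0.
        apply/setP=> i; rewrite !inE.
        by case: (Q i d c); case: (maximal (Q i) c); case: (maximal (Q i) d);
           case: (t i == d).
      rewrite cards0 addn0; apply: subset_leq_card; apply/subsetP=> i.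
      rewrite !inE.
      by case: (Q i d c); case: (maximal (Q i) c); case: (maximal (Q i) d);
           case: (t i == d).
    - by apply: subset_leq_card; apply/subsetP=> i; rewrite !inE => /andP[].
    - by apply: subset_leq_card; apply/subsetP=> i; rewrite !inE => /andP[].
    - have : top_score t c + k2 <= #|c_max|; last by lia.
      rewrite /top_score /k2 -cardsUI.
      have -> : [set i | t i == c] :&: [set i in both_max | t i == d] = set0.
        apply/setP=> i; rewrite !inE; case: (t i =P c) => //= ->.
        by rewrite (eq_sym c) (negbTE dc) andbF.
      rewrite cards0 addn0; apply: subset_leq_card; apply/subsetP=> i.
      by rewrite !inE => /orP[/eqP <- //|/andP[/andP[]]].
    - have : top_score t d <= #|above_max| + k2 + k3; last by lia.
      rewrite /top_score.
      have sub : [set i | t i == d] \subset above_max :|: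
          [set i in both_max | t i == d] :|: [set i in swing | t i == d].
        apply/subsetP=> i; rewrite !inE => /eqP tid; move: (tmax i).
        rewrite tid eqxx => ->.
        by case: (Q i d c); case: (maximal (Q i) c).
      have := subset_leq_card sub.
      by have := cardsU above_max [set i in both_max | t i == d];
         have := cardsU (above_max :|: [set i in both_max | t i == d])
           [set i in swing | t i == d]; rewrite -/k2 -/k3; lia.
  exists t; split=> [i _ //||y yc yd].
  - apply: subset_leq_card; apply/subsetP=> i.
    rewrite !inE => /andP[h /eqP tid]; move: h (tmax i).
    by rewrite tid eqxx => /andP[-> h] md; move: h; rewrite md !andbT.
  - have := tc y yc yd; have := td y yc yd.
    have : #|[set i in active | t i == y]| <= top_score t y; last by lia.
    by apply: subset_leq_card; apply/subsetP=> i; rewrite !inE => /andP[].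
have [|X2 [_ X2b cX2]] := @subset_of_card _ set0 both_max k2 (sub0set _).
  by rewrite cards0.
have subsw : [set i in active | g i == d] \subset swing.
  apply/subsetP=> i; rewrite in_set => /andP[acti /eqP gid].
  have := gmax i acti; rewrite gid => md.
  by move: acti; rewrite !inE md !andbT.
(* [X3] contains all voters whom [g] sends to [d]: one left out would count for [d] in the runoff
   without being budgeted. It is padded to exactly [k3], on which the score of [d] relies. *)
have [|X3 [X3g X3s cX3]] := @subset_of_card _ _ swing k3 subsw.
  by rewrite gd.
pose t i := if (i \in above_max) || (i \in X2) || (i \in X3) then d
            else if maximal (Q i) c then c else g i.
have tE y i : y != c -> y != d -> t i == y -> (i \in active) && (g i == y).
  rewrite /t => yc yd; case: ifP => [_|]; first by rewrite eq_sym (negbTE yd).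
  move/negbT; rewrite !negb_or => /andP[/andP[nA _] _].
  case: ifPn => [_|nc]; first by rewrite eq_sym (negbTE yc).
  by move->; rewrite inE nc andbT /=; move: nA; rewrite inE.
have s_y y : y != c -> y != d -> top_score t y <= T.
  move=> yc yd; apply: leq_trans (gT y yc yd).
  by apply: subset_leq_card; apply/subsetP=> i; rewrite !inE => /(tE _ _ yc yd);
    rewrite !inE.
have s_c : T <= top_score t c.
  suff: #|c_max| <= top_score t c + k2 by lia.
  rewrite -cX2 -[leqRHS](cardsUI); apply: leq_trans (leq_addr _ _).
  apply: subset_leq_card; apply/subsetP=> i; rewrite !inE => mc.
  rewrite /t !inE mc max_d_nc //=.
  have [/(subsetP X3s)|_] := boolP (i \in X3); first by rewrite !inE mc.
  by case: (i \in X2); rewrite ?orbT ?orbF ?eqxx.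
have s_d : T <= top_score t d.
  suff: #|above_max| + k2 + k3 <= top_score t d by lia.
  rewrite -cX2 -cX3 -cardsUI.
  have -> : above_max :&: X2 = set0.
    apply/setP=> i; rewrite !inE; apply/negbTE/negP => /andP[/andP[dci _]].
    by move/(subsetP X2b); rewrite inE => /andP[/max_d_nc]; rewrite dci.
  rewrite cards0 addn0 -cardsUI.
  have -> : (above_max :|: X2) :&: X3 = set0.
    apply/setP=> i; rewrite !inE; apply/negbTE/negP => /andP[h].
    move/(subsetP X3s); rewrite inE => /and3P[nc ndc _].
    case/orP: h => [|/(subsetP X2b)]; first by rewrite (negbTE ndc).
    by rewrite inE (negbTE nc).
  rewrite cards0 addn0; apply: subset_leq_card; apply/subsetP=> i.
  by rewrite !in_setU => h; rewrite in_set /t h.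
exists t; split.
- move=> i; rewrite /t; case: ifP => [|].
    case/orP=> [/orP[|/(subsetP X2b)]|/(subsetP X3s)]; rewrite inE.
    + by case/andP.
    + by case/andP.
    + by case/and3P.
  move/negbT; rewrite !negb_or => /andP[/andP[nA _] _].
  case: ifPn => // nc; apply: gmax; rewrite inE nc /=.
  by move: nA; rewrite inE.
- by move=> y yc yd; apply: leq_trans (s_y y yc yd) s_c.
- by move=> y yc yd; apply: leq_trans (s_y y yc yd) s_d.
- apply: leq_trans half; rewrite leq_double -cX2 -cX3.
  suff sub : [set i | Q i d c || (t i == d)] \subset above :|: X2 :|: X3.
    have := subset_leq_card sub; have := cardsU above X2.
    by have := cardsU (above :|: X2) X3; lia.
  apply/subsetP=> i; rewrite !inE; case/orP=> [-> //|].
  rewrite /t; case: ifP => [|/negbT].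
    by rewrite inE => /orP[/orP[/andP[-> _]|->]|->]; rewrite ?orbT.
  case: ifP => [_ _|/negbT nc]; first by rewrite eq_sym (negbTE dc).
  rewrite !negb_or => /andP[/andP[nA nX2] nX3] /eqP gid.
  case/negP: nX3; apply: (subsetP X3g); rewrite inE gid eqxx andbT inE nc.
  by move: nA; rewrite inE => ->.
Qed.

End Slots.

(** * Placing voters under capacities by push-relabel *)

(** The two differing terms are crossed over to avoid subtraction. *)
Lemma sum_change1 (n i : nat) (A : pred nat) (F G : nat -> nat) :
  i < n -> A i -> (forall j, j != i -> F j = G j) ->
  \sum_(j < n | A j) F j + G i = \sum_(j < n | A j) G j + F i.
Proof.
move=> lin Ai FG; rewrite (bigD1 (Ordinal lin)) //= [in RHS](bigD1 (Ordinal lin)) //=.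
rewrite (eq_bigr (fun j : 'I_n => G j)); first by lia.
by move=> j /andP[_]; rewrite -val_eqE; apply: FG.
Qed.

Section PushRelabel.
Variables (n m : nat) (act : pred nat) (al : rel nat) (cap : nat -> nat).
Implicit Types (f h : nat -> nat) (x y i : nat).

Definition load f y := \sum_(i < n | act i) (f i == y).

Definition feasible : Prop :=
  exists g, (forall i, i < n -> act i -> g i < m /\ al i (g i)) /\
            (forall y, y < m -> load g y <= cap y).

Definition overloaded f y := (y < m) && (cap y < load f y).

(* The last clause bounds the number of steps: each of the first t steps adds at
   least 1 to the potential \sum_y (n + 1) h y - \sum_i h (f i). *)
Definition preflow (t : nat) f h : Prop :=
  [/\ forall i, i < n -> act i -> f i < m /\ al i (f i),
      forall i y, i < n -> act i -> y < m -> al i y -> h (f i) <= (h y).+1,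
      forall y, y < m -> 0 < h y -> cap y <= load f y,
      feasible -> forall y, y < m -> h y < m
    & (forall y, ~~ overloaded f y) \/
      t + \sum_(i < n | act i) h (f i) <= \sum_(y < m) n.+1 * h y].

Definition upd f a b := fun x => if x == a then b else f x.

Lemma load_upd f i y x :
  i < n -> act i ->
  load (upd f i y) x + (x == f i) = load f x + (x == y).
Proof.
move=> lin acti; rewrite (eq_sym x (f i)) (eq_sym x y).
rewrite (@sum_change1 _ i act (fun j => upd f i y j == x) (fun j => f j == x)) //.
  by rewrite /upd eqxx.
by move=> j /negbTE ji; rewrite /upd ji.
Qed.

Lemma preflow_start c f h :
  c < m -> (forall i, al i c) ->
  (forall i, i < n -> f i = c) -> (forall y, y < m -> h y = 0) -> preflow 0 f h.
Proof.
move=> cm alc fc h0; split.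
- by move=> i lin _; rewrite fc.
- by move=> i y lin _ _ _; rewrite fc // h0.
- by move=> y ym; rewrite h0.
- by move=> _ y ym; rewrite h0 //; lia.
- by right; rewrite big1 // => i _; rewrite fc // h0.
Qed.

(** An idle step: the counter goes on after the last overload has vanished, since the number of
    steps is fixed in advance. *)
Lemma preflow_stop t f h :
  (forall y, ~~ overloaded f y) -> preflow t f h -> preflow t.+1 f h.
Proof. by move=> no [? ? ? ? _]; split=> //; left. Qed.

(** The alternative that voter [i] leaves stays saturated because it was overloaded, and labels stay
    valid because [y] has a smaller one. The potential grows since [i] moves to a smaller label. *)
Lemma preflow_push t f h i y :
  i < n -> act i -> overloaded f (f i) -> y < m -> al i y -> h y < h (f i) ->
  preflow t f h -> preflow t.+1 (upd f i y) h.
Proof.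
move=> lin acti /andP[fim ov] ym aliy hlt [P1 P2 P3 P4 P5].
have fiy : f i != y by apply: contraTneq hlt => ->; rewrite ltnn.
split=> //.
- by move=> j jn actj; rewrite /upd; case: eqP => [->|_]; [|apply: P1].
- move=> j z jn actj zm aljz; rewrite /upd; case: eqP => [ji|_]; last exact: P2.
  by subst j; have := P2 i z lin acti zm aljz; lia.
- move=> z zm hz; have := load_upd f y z lin acti; have := P3 z zm hz.
  by move: ov; case: eqP => [->|]; case: eqP; lia.
- right; case: P5 => [/(_ (f i))|]; first by rewrite /overloaded fim ov.
  have E j : j != i -> h (upd f i y j) = h (f j) by rewrite /upd => /negbTE ->.
  have := sum_change1 lin acti E; rewrite [upd f i y i]/upd eqxx.
  by lia.
Qed.

(* If h y = m - 1, the other labels miss a level l < m. The alternatives labelled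
   above l are saturated, y is overloaded, and the voters placed at any of these
   are allowed nowhere else, so no placement respects the capacities. *)
Lemma stuck_label f h y :
  (forall i, i < n -> act i -> f i < m /\ al i (f i)) ->
  (forall i y, i < n -> act i -> y < m -> al i y -> h (f i) <= (h y).+1) ->
  (forall y, y < m -> 0 < h y -> cap y <= load f y) ->
  overloaded f y -> (forall z, z < m -> h z < m) ->
  (forall i z, i < n -> act i -> f i = y -> z < m -> al i z -> h y <= h z) ->
  feasible -> (h y).+1 < m.
Proof.
move=> P1 P2 P3 /andP[ym ov] hm stuck [g [gal gcap]].
rewrite ltn_neqAle hm // andbT; apply/eqP => hy.
(* The m - 1 alternatives other than [y] cannot occupy all m levels. *)
have [l lm gap] : exists2 l, l < m & forall z, z < m -> z != y -> h z != l.
  pose s := [set @inord m.-1 (h (z : 'I_m)) | z in ~: [set Ordinal ym]].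
  have cs : #|s| <= m.-1.
    apply: leq_trans (leq_imset_card _ _) _.
    by rewrite cardsC1 card_ord.
  have : 0 < #|~: s| by have := cardsC s; rewrite card_ord; lia.
  case/card_gt0P=> l; rewrite inE => nls; exists (l : nat).
    by have := ltn_ord l; lia.
  move=> z zm zy; apply: contra nls => /eqP hl; apply/imsetP.
  exists (Ordinal zm); first by rewrite !inE -val_eqE.
  by rewrite /= hl inord_val.
pose S z := (l <= h z) || (z == y).
(* A voter labelled above the empty level [l] can descend by at most one and cannot land on [l]; a
   voter at [y] reaches only labels of at least m - 1. *)
have Sclosed i z : i < n -> act i -> S (f i) -> z < m -> al i z -> S z.
  move=> lin acti Sfi zm aliz; rewrite /S.
  have [->|zy] := eqVneq z y; first by rewrite orbT.
  have nl := gap z zm zy.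
  have [fiy|fiy] := eqVneq (f i) y.
    by have := stuck i z lin acti fiy zm aliz; lia.
  have := P2 i z lin acti zm aliz; have := gap (f i) (P1 i lin acti).1 fiy.
  by move: Sfi; rewrite /S (negbTE fiy) orbF; lia.
have total k : (forall i, i < n -> act i -> k i < m) ->
    \sum_(z < m | S z) load k z = \sum_(i < n | act i) S (k i).
  move=> km; rewrite exchange_big /=; apply: eq_bigr => i acti.
  rewrite (big_mkcond) (bigD1 (Ordinal (km i (ltn_ord i) acti))) //= eqxx.
  rewrite big1 ?addn0; first by case: (S _).
  by move=> z; rewrite -val_eqE /= eq_sym => /negbTE ->; case: ifP.
have lt1 : \sum_(z < m | S z) cap z < \sum_(z < m | S z) load f z.
  have Sy : S (Ordinal ym) by rewrite /S eqxx orbT.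
  rewrite (bigD1 (Ordinal ym)) //= [leqRHS](bigD1 (Ordinal ym)) //=.
  rewrite -addSn leq_add //; apply: leq_sum => z /andP[/orP[lz|/eqP zy] zny].
    (* Apart from [y], a label 0 in [S] would have to be the empty level [l]. *)
    have [h0|hz] := posnP (h z); last by apply: P3 => //.
    have := gap z (ltn_ord z); rewrite -val_eqE in zny; move/(_ zny).
    by move: lz; rewrite h0; case: (l).
  by case/negP: zny; rewrite -val_eqE /= zy.
have le2 : \sum_(z < m | S z) load f z <= \sum_(z < m | S z) load g z.
  rewrite !total => [|i lin acti|i lin acti]; last 2 first.
  - by case: (gal i lin acti).
  - by case: (P1 i lin acti).
  apply: leq_sum => i acti; case Sfi: (S (f i)) => //.
  by have [gm alg] := gal i (ltn_ord i) acti; rewrite (Sclosed i).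
have le3 : \sum_(z < m | S z) load g z <= \sum_(z < m | S z) cap z.
  by apply: leq_sum => z _; apply: gcap.
by move: (leq_trans lt1 (leq_trans le2 le3)); rewrite ltnn.
Qed.

(** This step dictates the weight n + 1 in the potential: raising the label of [y] adds n + 1 to the
    first sum and, through the voters placed at [y], at most n to the second. *)
Lemma preflow_relabel t f h y :
  overloaded f y ->
  (forall i z, i < n -> act i -> f i = y -> z < m -> al i z -> h y <= h z) ->
  preflow t f h -> preflow t.+1 f (upd h y (h y).+1).
Proof.
move=> ovy stuck [P1 P2 P3 P4 P5]; have /andP[ym ov] := ovy.
split=> //.
- move=> i z lin acti zm aliz; rewrite /upd.
  case: (f i =P y) => [fiy|fiy]; case: (z =P y) => zy.
  + exact: leqnSn.
  + by have := stuck i z lin acti fiy zm aliz; lia.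
  + by have := P2 i y lin acti ym; rewrite -{1}zy => /(_ aliz); lia.
  + exact: P2.
- move=> z zm; rewrite /upd; case: eqP => [-> _|_]; first exact: ltnW.
  exact: P3.
- move=> feas z zm; have hm := P4 feas; rewrite /upd.
  by case: eqP => [_|_]; [apply: (stuck_label P1)|apply: hm].
- right; case: P5 => [/(_ y)|]; first by rewrite ovy.
  have -> : \sum_(z < m) n.+1 * upd h y (h y).+1 z =
            \sum_(z < m) n.+1 * h z + n.+1.
    have E z : z != y -> n.+1 * upd h y (h y).+1 z = n.+1 * h z.
      by rewrite /upd => /negbTE ->.
    have := @sum_change1 m y predT _ _ ym isT E.
    rewrite [upd h y _ y]/upd eqxx mulnS /=.
    by lia.
  have : \sum_(i < n | act i) upd h y (h y).+1 (f i) <=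
         \sum_(i < n | act i) h (f i) + n; last by lia.
  apply: leq_trans (_ : \sum_(i < n | act i) (h (f i) + 1) <= _).
    by apply: leq_sum => i _; rewrite /upd; case: eqP => [->|_]; lia.
  rewrite big_split leq_add2l sum_nat_const muln1.
  by apply: leq_trans (max_card _) _; rewrite card_ord.
Qed.

(** In a feasible instance all labels are below m, so the potential is at most (n + 1) m (m - 1),
    and an overload cannot survive (n + 1) m m steps. Conversely, a preflow without overload is
    itself a placement. *)
Lemma preflow_decides t f h :
  0 < m -> n.+1 * m * m <= t -> preflow t f h ->
  (forall y, ~~ overloaded f y) <-> feasible.
Proof.
move=> m0 tbig [P1 P2 P3 P4 P5]; split=> [no|feas].
  exists f; split=> // y ym; have := no y.
  by rewrite /overloaded ym /= -leqNgt.
case: P5 => // bound; have hm := P4 feas.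
have : \sum_(y < m) n.+1 * h y <= \sum_(y < m) n.+1 * m.-1.
  by apply: leq_sum => y _; rewrite leq_mul2l; have := hm y (ltn_ord y); lia.
rewrite sum_nat_const card_ord; move: bound tbig.
move: (\sum_(i < n | _) _) (\sum_(y < m) _) => u v.
by case: (m) m0 => // m' _ /=; nia.
Qed.

End PushRelabel.

(** * A language of polynomial-time programs *)

(* Valid for programs whose loops each run at most L times. *)
Fixpoint time_bound (L : nat) (p : prog) : nat :=
  match p with
  | Skip => 1
  | Write a e => (expr_cost a + expr_cost e).+1
  | Seq p q => (time_bound L p + time_bound L q).+1
  | If e p q => (expr_cost e + time_bound L p + time_bound L q).+1
  | While e p => (L * (expr_cost e + time_bound L p).+1 + expr_cost e).+1
  end.

Lemma time_bound_poly p : exists a k, forall L, time_bound L p <= a * L ^ k + a.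
Proof.
(* The base [L.+1] is positive, so its powers grow with the exponent and absorb constants. The way
   back to [L] uses L + 1 <= 2 L for positive [L]; the summand [a] covers [L] = 0. *)
suff [a [k ak]] : exists a k, forall L, time_bound L p <= a * L.+1 ^ k.
  exists (a * 2 ^ k), k => -[|L].
    apply: leq_trans (ak 0) _; rewrite exp1n muln1 -mulnA.
    apply: leq_trans (leq_addl _ _).
    by rewrite leq_pmulr ?expn_gt0.
  apply: leq_trans (ak L.+1) _; rewrite -mulnA -expnMn.
  apply: leq_trans (leq_addr _ _); rewrite leq_mul2l; apply/orP; right.
  by case: k {ak} => // k; rewrite leq_exp2r //; lia.
have mono a k k' L : k <= k' -> a * L.+1 ^ k <= a * L.+1 ^ k'.
  by move=> kk'; rewrite leq_mul2l leq_pexp2l ?orbT.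
have one k L : 0 < L.+1 ^ k by rewrite expn_gt0.
elim: p => /= [|a e|p [a [k IHp]] q [b [l IHq]]
  |e p [a [k IHp]] q [b [l IHq]]|e p [a [k IHp]]].
- by exists 1, 0 => L.
- by exists (expr_cost a + expr_cost e).+1, 0 => L; rewrite expn0 muln1.
- exists (a + b).+1, (maxn k l) => L.
  have := mono a k _ L (leq_maxl k l); have := mono b l _ L (leq_maxr k l).
  have := IHp L; have := IHq L; have := one (maxn k l) L.
  by rewrite mulSn mulnDl; lia.
- exists (expr_cost e + a + b).+1, (maxn k l) => L.
  have := mono a k _ L (leq_maxl k l); have := mono b l _ L (leq_maxr k l).
  have := IHp L; have := IHq L; have := one (maxn k l) L.
  rewrite mulSn !mulnDl.
  have : expr_cost e <= expr_cost e * L.+1 ^ maxn k l by rewrite leq_pmulr.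
  by lia.
- exists (expr_cost e + a).+1, k.+1 => L; have := IHp L; have := one k L.
  rewrite expnS; move: (L.+1 ^ k) (time_bound L p) (expr_cost e) => x y z.
  by move=> x0 le_y; nia.
Qed.

(** A total-correctness triple with the syntactic time bound built in, so that program proofs need
    not track time. *)
Definition does (L : nat) (p : prog) (M : memory) (Q : memory -> Prop) : Prop :=
  exists t M', [/\ exec p M t M', t <= time_bound L p & Q M'].

Lemma does_conseq L p M (Q Q' : memory -> Prop) :
  does L p M Q -> (forall M', Q M' -> Q' M') -> does L p M Q'.
Proof. by case=> t [M' [? ? /[swap] QQ' /QQ' ?]]; exists t, M'. Qed.

Lemma does_write L a e M (Q : memory -> Prop) :
  Q (update M (eval M a) (eval M e)) -> does L (Write a e) M Q.
Proof. by move=> QM; do 2 eexists; split; [exact: ExecWrite| |]. Qed.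

Lemma does_seq L p q M (Q : memory -> Prop) :
  does L p M (fun M' => does L q M' Q) -> does L (Seq p q) M Q.
Proof.
case=> t [M1 [ex1 le1 [u [M2 [ex2 le2 QM2]]]]].
do 2 eexists; split; [exact: ExecSeq ex1 ex2| |exact: QM2].
by rewrite /= ltnS leq_add.
Qed.

Lemma does_if L e p q M (Q : memory -> Prop) :
  does L (if eval M e != 0 then p else q) M Q -> does L (If e p q) M Q.
Proof.
case: ifPn => [nz|/negPn/eqP z] [t [M' [ex le_t QM']]]; do 2 eexists; split.
- exact: ExecIfTrue nz ex.
- by rewrite /=; lia.
- exact: QM'.
- exact: ExecIfFalse z ex.
- by rewrite /=; lia.
- exact: QM'.
Qed.

Lemma does_while L e p M (Inv : nat -> memory -> Prop) :
  Inv 0 M ->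
  (forall j M', j < L -> Inv j M' -> eval M' e != 0 /\ does L p M' (Inv j.+1)) ->
  (forall M', Inv L M' -> eval M' e = 0) ->
  does L (While e p) M (Inv L).
Proof.
move=> Inv0 step stop.
suff rest k j M' : j + k = L -> Inv j M' -> exists t M'',
    [/\ exec (While e p) M' t M'',
        t <= (k * (expr_cost e + time_bound L p).+1 + expr_cost e).+1
      & Inv L M''].
  by have [t [M'' [ex le_t]]] := rest L 0 M erefl Inv0; exists t, M''.
elim: k j M' => [|k IHk] j M'.
  rewrite addn0 => -> InvL; do 2 eexists; split; last exact: InvL.
    exact: ExecWhileDone (stop _ InvL).
  by rewrite mul0n.
move=> jk Invj; have jL : j < L by lia.
have [nz [t [M1 [ex1 le1 Inv1]]]] := step j M' jL Invj.
have [|u [M2 [ex2 le2 InvL]]] := IHk j.+1 M1 _ Inv1; first by lia.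
do 2 eexists; split; [exact: ExecWhileStep nz ex1 ex2| |exact: InvL].
by rewrite mulSn; lia.
Qed.

(* A store is a family of arrays, indexed by tracks; entry 0 of a track serves
   as a scalar variable. *)
Definition store : Type := nat -> nat -> nat.

Definition set_entry (s : store) (a i x : nat) : store :=
  fun b j => if (b == a) && (j == i) then x else s b j.

(** [ESum] is the only iterating expression: bounded quantifiers, products and least-index search
    are derived from it, free of side effects. *)
Inductive exp : Type :=
  | ENum of nat
  | ELen
  | EBit of exp
  | EGet of nat & exp
  | EAdd of exp & exp
  | ESub of exp & exp
  | EIf of exp & exp & exp
  | ESum of nat & exp.

Inductive cmd : Type :=
  | CSet of nat & exp & exp
  | CSeq of cmd & cmd
  | CIf of exp & cmd & cmd
  | CFor of nat & cmd.

Section Semantics.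
Variable w : seq bool.

(* All sums and loops range over 0, ..., L - 1 with L the length of the input. *)
Fixpoint ev (e : exp) (s : store) : nat :=
  match e with
  | ENum k => k
  | ELen => size w
  | EBit e1 => nth false w (ev e1 s)
  | EGet a e1 => s a (ev e1 s)
  | EAdd e1 e2 => ev e1 s + ev e2 s
  | ESub e1 e2 => ev e1 s - ev e2 s
  | EIf e1 e2 e3 => if ev e1 s != 0 then ev e2 s else ev e3 s
  | ESum v e1 => \sum_(j < size w) ev e1 (set_entry s v 0 j)
  end.

(** The loop variable is reset from the iteration number at each round, so the body may overwrite
    it, and nested loops may share it. *)
Fixpoint run (c : cmd) (s : store) : store :=
  match c with
  | CSet a e1 e2 => set_entry s a (ev e1 s) (ev e2 s)
  | CSeq c1 c2 => run c2 (run c1 s)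
  | CIf e c1 c2 => if ev e s != 0 then run c1 s else run c2 s
  | CFor v c1 => foldl (fun s' j => run c1 (set_entry s' v 0 j)) s (iota 0 (size w))
  end.

Lemma run_for_ind (Inv : nat -> store -> Prop) v c s :
  Inv 0 s ->
  (forall j s', j < size w -> Inv j s' -> Inv j.+1 (run c (set_entry s' v 0 j))) ->
  Inv (size w) (run (CFor v c) s).
Proof.
move=> Inv0 step /=.
suff H k : k <= size w ->
  Inv k (foldl (fun s' j => run c (set_entry s' v 0 j)) s (iota 0 k)) by exact: H.
elim: k => // k IHk lek; rewrite -addn1 iotaD cats1 foldl_rcons addn1.
by apply: step => //; apply: IHk; apply: ltnW.
Qed.

Fixpoint writes (c : cmd) : seq nat :=
  match c with
  | CSet a _ _ => [:: a]
  | CSeq c1 c2 | CIf _ c1 c2 => writes c1 ++ writes c2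
  | CFor v c1 => v :: writes c1
  end.

Lemma run_frame c s a i : a \notin writes c -> run c s a i = s a i.
Proof.
elim: c s => [b e1 e2|c1 IH1 c2 IH2|e c1 IH1 c2 IH2|v c IH] s /=.
- by rewrite inE /set_entry => /negbTE ->.
- by rewrite mem_cat negb_or => /andP[n1 n2]; rewrite IH2 ?IH1.
- by rewrite mem_cat negb_or => /andP[n1 n2]; case: ifP; [rewrite IH1|rewrite IH2].
- rewrite inE negb_or => /andP[nv nc].
  apply: (run_for_ind (Inv := fun _ s' => s' a i = s a i)) => // j s' _ <-.
  by rewrite IH // /set_entry (negbTE nv).
Qed.

End Semantics.

(** * Compilation to the machine *)

Section Compiler.
(* Tracks below u belong to the source program, tracks from u to W - 1 to the
   compiler; entry i of track a lives in the cell (length of input) + 1 + W i + a. *)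
Variables (u W : nat).

(** The machine cannot multiply; as [W] depends on the program only, [W] times the index is a sum of
    fixed length. *)
Definition addr (a : nat) (e : expr) : expr :=
  Add (Read (Const 0)) (Add (Const a.+1) (iter W (Add e) (Const 0))).
Definition var (a : nat) : expr := Add (Read (Const 0)) (Const a.+1).

(** The result goes to track [k], and tracks from [k] on are scratch. [EBit] tests the range first,
    since the cells past the input hold the store. [ESum] keeps the partial sum in [k], the counter
    in [k.+1] and the old value of the bound variable in [k.+2]. *)
Fixpoint comp (e : exp) (k : nat) : prog :=
  match e with
  | ENum x => Write (var k) (Const x)
  | ELen => Write (var k) (Read (Const 0))
  | EBit e1 =>
      Seq (comp e1 k)
          (If (Defs.Sub (Read (Const 0)) (Read (var k)))
              (Write (var k) (Read (Add (Read (var k)) (Const 1))))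
              (Write (var k) (Const 0)))
  | EGet a e1 => Seq (comp e1 k) (Write (var k) (Read (addr a (Read (var k)))))
  | EAdd e1 e2 =>
      Seq (comp e1 k) (Seq (comp e2 k.+1)
        (Write (var k) (Add (Read (var k)) (Read (var k.+1)))))
  | ESub e1 e2 =>
      Seq (comp e1 k) (Seq (comp e2 k.+1)
        (Write (var k) (Defs.Sub (Read (var k)) (Read (var k.+1)))))
  | EIf e1 e2 e3 =>
      Seq (comp e1 k) (If (Read (var k)) (comp e2 k) (comp e3 k))
  | ESum v e1 =>
      Seq (Write (var k) (Const 0))
     (Seq (Write (var k.+1) (Const 0))
     (Seq (Write (var k.+2) (Read (var v)))
     (Seq (While (Defs.Sub (Read (Const 0)) (Read (var k.+1)))
            (Seq (Write (var v) (Read (var k.+1)))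
            (Seq (comp e1 k.+3)
            (Seq (Write (var k) (Add (Read (var k)) (Read (var k.+3))))
                 (Write (var k.+1) (Add (Read (var k.+1)) (Const 1)))))))
          (Write (var v) (Read (var k.+2))))))
  end.

(** A loop counter lives in the scratch track [k], out of reach of the body, which is compiled from
    [k.+1] on. *)
Fixpoint ccomp (c : cmd) (k : nat) : prog :=
  match c with
  | CSet a e1 e2 =>
      Seq (comp e1 k) (Seq (comp e2 k.+1)
        (Write (addr a (Read (var k))) (Read (var k.+1))))
  | CSeq c1 c2 => Seq (ccomp c1 k) (ccomp c2 k)
  | CIf e c1 c2 => Seq (comp e k) (If (Read (var k)) (ccomp c1 k) (ccomp c2 k))
  | CFor v c1 =>
      Seq (Write (var k) (Const 0))
          (While (Defs.Sub (Read (Const 0)) (Read (var k)))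
            (Seq (Write (var v) (Read (var k)))
            (Seq (ccomp c1 k.+1)
                 (Write (var k) (Add (Read (var k)) (Const 1))))))
  end.

Fixpoint efits (e : exp) (k : nat) : bool :=
  (k < W) &&
  match e with
  | ENum _ | ELen => true
  | EBit e1 => efits e1 k
  | EGet a e1 => (a < u) && efits e1 k
  | EAdd e1 e2 | ESub e1 e2 => efits e1 k && efits e2 k.+1
  | EIf e1 e2 e3 => [&& efits e1 k, efits e2 k & efits e3 k]
  | ESum v e1 => (v < u) && efits e1 k.+3
  end.

Fixpoint cfits (c : cmd) (k : nat) : bool :=
  match c with
  | CSet a e1 e2 => [&& a < u, efits e1 k & efits e2 k.+1]
  | CSeq c1 c2 => cfits c1 k && cfits c2 k
  | CIf e c1 c2 => [&& efits e k, cfits c1 k & cfits c2 k]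
  | CFor v c1 => [&& v < u, k < W & cfits c1 k.+1]
  end.

Lemma efits_lt e k : efits e k -> k < W.
Proof. by case: e => [x||e1|a e1|e1 e2|e1 e2|e1 e2 e3|v e1] /andP[]. Qed.

Variable w : seq bool.

Definition loc (a i : nat) : nat := size w + a.+1 + W * i.

Definition represents (M : memory) (s : store) : Prop :=
  [/\ M 0 = size w, forall i, i < size w -> M i.+1 = nth false w i
    & forall a i, a < u -> M (loc a i) = s a i].

Definition keeps (k : nat) (M M' : memory) : Prop :=
  forall a i, u <= a < k -> M' (loc a i) = M (loc a i).

Lemma loc_inj a b i j : a < W -> b < W -> (loc a i == loc b j) = (a == b) && (i == j).
Proof.
move=> aW bW; apply/eqP/andP => [|[/eqP-> /eqP->] //]; rewrite /loc => e.
have {}e : i * W + a = j * W + b by rewrite ![_ * W]mulnC; lia.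
have W0 : 0 < W by lia.
have := congr1 (divn^~ W) e; rewrite !divnMDl // !divn_small // !addn0 => ij.
by split; apply/eqP => //; move: e; rewrite ij; lia.
Qed.

Lemma update_loc M a i x b j : a < W -> b < W ->
  update M (loc a i) x (loc b j) = if (b == a) && (j == i) then x else M (loc b j).
Proof. by move=> aW bW; rewrite /update loc_inj. Qed.

Hypothesis uW : u <= W.

Lemma represents_temp M s a i x :
  u <= a < W -> represents M s -> represents (update M (loc a i) x) s.
Proof.
move=> /andP[ua aW] [M0 Mw Ms]; split.
- by rewrite /update ifN // /loc; lia.
- by move=> j jw; rewrite /update ifN ?Mw // /loc; lia.
- move=> b j bu; rewrite update_loc ?Ms //; last exact: leq_trans bu uW.
  by rewrite ifN //; lia.
Qed.

Lemma represents_set M s a i x :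
  a < u -> represents M s ->
  represents (update M (loc a i) x) (set_entry s a i x).
Proof.
move=> au [M0 Mw Ms]; split.
- by rewrite /update ifN // /loc; lia.
- by move=> j jw; rewrite /update ifN ?Mw // /loc; lia.
- move=> b j bu; rewrite update_loc ?Ms //; exact: leq_trans _ uW.
Qed.

Lemma represents_ext M s s' :
  (forall a i, s a i = s' a i) -> represents M s -> represents M s'.
Proof. by move=> ss' [? ? Ms]; split=> // a i /Ms ->. Qed.

Lemma keeps_refl k M : keeps k M M. Proof. by []. Qed.

Lemma keeps_trans k M1 M2 M3 : keeps k M1 M2 -> keeps k M2 M3 -> keeps k M1 M3.
Proof. by move=> h12 h23 a i ak; rewrite h23 ?h12. Qed.

Lemma keeps_le k k' M M' : k <= k' -> keeps k' M M' -> keeps k M M'.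
Proof. by move=> kk' h a i ak; apply: h; lia. Qed.

Lemma keeps_update k M a i x :
  a < W -> (a < u) || (k <= a) -> k <= W -> keeps k M (update M (loc a i) x).
Proof.
move=> aW ak kW b j bk; rewrite update_loc //; last by lia.
by rewrite ifN //; lia.
Qed.

Lemma eval_var M a : M 0 = size w -> eval M (var a) = loc a 0.
Proof. by rewrite /= => ->; rewrite /loc muln0 addn0. Qed.

Lemma eval_addr M a e : M 0 = size w -> eval M (addr a e) = loc a (eval M e).
Proof.
rewrite /= => ->; rewrite /loc -addnA; congr (_ + (_ + _)).
by elim: W => //= n ->; rewrite mulSn.
Qed.

Notation L := (size w).

Lemma evalE M : M 0 = size w ->
  ((forall a, eval M (Read (var a)) = M (loc a 0)) *
   (forall a, eval M (var a) = loc a 0) *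
   (forall a e, eval M (addr a e) = loc a (eval M e)) *
   (eval M (Read (Const 0)) = size w) *
   (forall x, eval M (Const x) = x) *
   (forall e1 e2, eval M (Add e1 e2) = (eval M e1 + eval M e2)%N) *
   (forall e1 e2, eval M (Defs.Sub e1 e2) = (eval M e1 - eval M e2)%N) *
   (forall e, eval M (Read e) = M (eval M e)))%type.
Proof.
move=> M0; do !split=> //; first by move=> a; congr (M _); apply: eval_var.
- by move=> a; apply: eval_var.
- by move=> a e; apply: eval_addr.
Qed.

Lemma represents0 M s : represents M s -> M 0 = size w.
Proof. by case. Qed.

Definition computed k M s x (M' : memory) : Prop :=
  [/\ represents M' s, keeps k M M' & M' (loc k 0) = x].

Lemma computed_update k M0 M s x :
  u <= k < W -> represents M s -> keeps k M0 M ->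
  computed k M0 s x (update M (loc k 0) x).
Proof.
move=> /andP[uk kW] R K; split.
- by apply: represents_temp R; rewrite uk.
- by apply: keeps_trans K _; apply: keeps_update; rewrite ?leqnn ?orbT // ltnW.
- by rewrite update_loc // !eqxx.
Qed.

Lemma comp_correct e k M s :
  efits e k -> u <= k -> represents M s ->
  does L (comp e k) M (computed k M s (ev w e s)).
Proof.
elim: e k M s => [x||e1 IH1|a e1 IH1|e1 IH1 e2 IH2|e1 IH1 e2 IH2
  |e1 IH1 e2 IH2 e3 IH3|v e1 IH1] k M s fits uk R; have kW := efits_lt fits;
  have ukW : u <= k < W by rewrite uk.
- by apply: does_write; rewrite !(evalE (represents0 R)); apply: computed_update.
- by apply: does_write; rewrite !(evalE (represents0 R)); apply: computed_update.
- have /andP[_ fits1] := fits.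
  apply/does_seq/(does_conseq (IH1 _ _ _ fits1 uk R)) => M1 [R1 K1 V1].
  apply/does_if; rewrite !(evalE (represents0 R1)) V1.
  case: ifP => [inw|outw]; apply: does_write; rewrite !(evalE (represents0 R1)).
    have wV : ev w e1 s < size w by move: inw; rewrite subn_eq0 -ltnNge.
    rewrite V1 addn1; have [_ Mw _] := R1; rewrite Mw //.
    exact: computed_update.
  by rewrite [ev _ _ _]/= nth_default ?[nat_of_bool _]/=; [apply: computed_update|lia].
- have /and3P[_ au fits1] := fits.
  apply/does_seq/(does_conseq (IH1 _ _ _ fits1 uk R)) => M1 [R1 K1 V1].
  apply: does_write; rewrite !(evalE (represents0 R1)) V1.
  by have [_ _ Ms] := R1; rewrite Ms //; apply: computed_update.
- have /and3P[_ fits1 fits2] := fits.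
  apply/does_seq/(does_conseq (IH1 _ _ _ fits1 uk R)) => M1 [R1 K1 V1].
  apply/does_seq/(does_conseq (IH2 _ _ _ fits2 (leqW uk) R1)) => M2 [R2 K2 V2].
  apply: does_write; rewrite !(evalE (represents0 R2)) V2 K2 ?uk ?leqnn // V1.
  apply: computed_update => //; apply: keeps_trans K1 _; exact: keeps_le K2.
- have /and3P[_ fits1 fits2] := fits.
  apply/does_seq/(does_conseq (IH1 _ _ _ fits1 uk R)) => M1 [R1 K1 V1].
  apply/does_seq/(does_conseq (IH2 _ _ _ fits2 (leqW uk) R1)) => M2 [R2 K2 V2].
  apply: does_write; rewrite !(evalE (represents0 R2)) V2 K2 ?uk ?leqnn // V1.
  apply: computed_update => //; apply: keeps_trans K1 _; exact: keeps_le K2.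
- have /and4P[_ fits1 fits2 fits3] := fits.
  apply/does_seq/(does_conseq (IH1 _ _ _ fits1 uk R)) => M1 [R1 K1 V1].
  apply/does_if; rewrite !(evalE (represents0 R1)) V1 [ev w (EIf _ _ _) s]/=.
  case: ifP => _; [apply: does_conseq (IH2 _ _ _ fits2 uk R1) _
                  |apply: does_conseq (IH3 _ _ _ fits3 uk R1) _] => M2 [R2 K2 V2];
  by split=> //; apply: keeps_trans K1 K2.
- have /and3P[_ vu fits1] := fits; have k3W := efits_lt fits1.
  have vW := leq_trans vu uW.
  have [k1W k2W] : k.+1 < W /\ k.+2 < W by lia.
  pose part j := \sum_(0 <= i < j) ev w e1 (set_entry s v 0 i).
  (* During the loop the store is represented only up to the bound variable, whose old value waits
     in track [k.+2]. *)
  pose Inv j M' := [/\ exists x, represents M' (set_entry s v 0 x), keeps k M M',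
    M' (loc k 0) = part j, M' (loc k.+1 0) = j & M' (loc k.+2 0) = s v 0].
  apply/does_seq/does_write; rewrite !(evalE (represents0 R)).
  have {R} [R1 K1 V1] := computed_update 0 ukW R (@keeps_refl k M).
  move: (update _ _ _) R1 K1 V1 => M1 R1 K1 V1.
  have uk1W : u <= k.+1 < W by lia.
  apply/does_seq/does_write; rewrite !(evalE (represents0 R1)).
  have [R2 K2 V2] := computed_update 0 uk1W R1 (@keeps_refl k.+1 M1).
  move: (update _ _ _) R2 K2 V2 => M2 R2 K2 V2.
  have uk2W : u <= k.+2 < W by lia.
  apply/does_seq/does_write; rewrite !(evalE (represents0 R2)).
  have [R3 K3 V3] := computed_update (M2 (loc v 0)) uk2W R2 (@keeps_refl k.+2 M2).
  move: (update _ _ _) R3 K3 V3 => M3 R3 K3 V3.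
  have Inv0 : Inv 0 M3.
    split.
    - exists (s v 0); apply: represents_ext R3 => a i; rewrite /set_entry.
      by case: andP => // -[/eqP-> /eqP->].
    - by apply: keeps_trans (keeps_trans K1 (keeps_le _ K2)) (keeps_le _ K3); lia.
    - by rewrite K3 ?K2 ?V1 /part ?big_nil //; lia.
    - by rewrite K3 //; lia.
    - by rewrite V3; have [_ _ ->] := R2.
  apply/does_seq; apply: does_conseq (does_while Inv0 _ _) _.
  + move=> j M4 jL [[x R4] K4 V4 C4 S4]; rewrite !(evalE (represents0 R4)) C4.
    split; first by lia.
    apply/does_seq/does_write; rewrite !(evalE (represents0 R4)) C4.
    have R5 : represents (update M4 (loc v 0) j) (set_entry s v 0 j).
      apply: represents_ext (represents_set 0 j vu R4) => a i; rewrite /set_entry.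
      by case: andP.
    have K5 : keeps k.+3 M4 (update M4 (loc v 0) j).
      by apply: keeps_update; rewrite ?vu // ltnW.
    move: (update _ _ _) R5 K5 => M5 R5 K5.
    have uk3 : u <= k.+3 by lia.
    apply/does_seq/(does_conseq (IH1 _ _ _ fits1 uk3 R5)) => M6 [R6 K6 V6].
    apply/does_seq/does_write; rewrite !(evalE (represents0 R6)) V6.
    have K46 := keeps_trans K5 K6.
    rewrite K46 ?V4; last by lia.
    have [R7 K7 V7] := computed_update (part j + ev w e1 (set_entry s v 0 j)) ukW R6
      (@keeps_refl k M6).
    have K7' a : u <= a < W -> a != k -> update M6 (loc k 0)
        (part j + ev w e1 (set_entry s v 0 j)) (loc a 0) = M6 (loc a 0).
      by move=> /andP[_ aW] /negbTE ak; rewrite update_loc // ak.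
    move: (update _ _ _) R7 K7 V7 K7' => M7 R7 K7 V7 K7'.
    apply/does_write; rewrite !(evalE (represents0 R7)).
    rewrite K7' //; last by lia.
    rewrite K46 ?C4 ?addn1; last by lia.
    have other a : a < W -> a != k.+1 ->
        update M7 (loc k.+1 0) j.+1 (loc a 0) = M7 (loc a 0).
      by move=> aW /negbTE ak; rewrite update_loc // ak.
    split.
    * by exists j; apply: represents_temp R7.
    * have K : keeps k M M7.
        by apply: keeps_trans K7; apply: keeps_trans K4 (keeps_le _ K46); lia.
      by apply: keeps_trans K _; apply: keeps_update; lia.
    * by rewrite other ?V7 /part ?big_nat_recr //; lia.
    * by rewrite update_loc // !eqxx.
    * by rewrite other ?K7' ?K46 //; lia.
  + by move=> M4 [[x R4] _ _ C4 _]; rewrite !(evalE (represents0 R4)) C4 subnn.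
  + move=> M4 [[x R4] K4 V4 C4 S4].
    apply/does_write; rewrite !(evalE (represents0 R4)) S4; split.
    * apply: represents_ext (represents_set 0 (s v 0) vu R4) => a i.
      by rewrite /set_entry; case: andP => // -[/eqP-> /eqP->].
    * by apply: keeps_trans K4 _; apply: keeps_update; rewrite ?vu // ltnW.
    * rewrite update_loc // ifN; last by lia.
      by rewrite V4 /part big_mkord.
Qed.

Lemma ccomp_correct c k M s :
  cfits c k -> u <= k -> represents M s ->
  does L (ccomp c k) M (fun M' => represents M' (run w c s) /\ keeps k M M').
Proof.
elim: c k M s => [a e1 e2|c1 IH1 c2 IH2|e c1 IH1 c2 IH2|v c1 IH1] k M s fits uk R.
- have /and3P[au fits1 fits2] := fits; have kW := efits_lt fits1.
  apply/does_seq/(does_conseq (comp_correct fits1 uk R)) => M1 [R1 K1 V1].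
  apply/does_seq/(does_conseq (comp_correct fits2 (leqW uk) R1)) => M2 [R2 K2 V2].
  apply/does_write; rewrite !(evalE (represents0 R2)) V2 K2 ?uk ?leqnn // V1.
  split; first exact: represents_set.
  have K12 := keeps_trans K1 (keeps_le (leqnSn k) K2).
  by apply: keeps_trans K12 _; apply: keeps_update; rewrite ?au ?(leq_trans au) // ltnW.
- have /andP[fits1 fits2] := fits.
  apply/does_seq/(does_conseq (IH1 _ _ _ fits1 uk R)) => M1 [R1 K1].
  apply: does_conseq (IH2 _ _ _ fits2 uk R1) _ => M2 [R2 K2].
  by split=> //; apply: keeps_trans K1 K2.
- have /and3P[fits0 fits1 fits2] := fits.
  apply/does_seq/(does_conseq (comp_correct fits0 uk R)) => M1 [R1 K1 V1].
  apply/does_if; rewrite !(evalE (represents0 R1)) V1 [run w (CIf _ _ _) s]/=.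
  case: ifP => _; [apply: does_conseq (IH1 _ _ _ fits1 uk R1) _
                  |apply: does_conseq (IH2 _ _ _ fits2 uk R1) _] => M2 [R2 K2];
  by split=> //; apply: keeps_trans K1 K2.
- have /and3P[vu kW fits1] := fits; have vW := leq_trans vu uW.
  have ukW : u <= k < W by rewrite uk.
  apply/does_seq/does_write; rewrite !(evalE (represents0 R)).
  have [R1 K1 V1] := computed_update 0 ukW R (@keeps_refl k M).
  move: (update _ _ _) R1 K1 V1 => M1 R1 K1 V1.
  pose st j := foldl (fun s' i => run w c1 (set_entry s' v 0 i)) s (iota 0 j).
  pose Inv j M' := [/\ represents M' (st j), keeps k M M' & M' (loc k 0) = j].
  have Inv0 : Inv 0 M1 by [].
  apply: does_conseq (does_while Inv0 _ _) _.
  + move=> j M2 jL [R2 K2 V2]; rewrite !(evalE (represents0 R2)) V2.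
    split; first by lia.
    apply/does_seq/does_write; rewrite !(evalE (represents0 R2)) V2.
    have R3 := represents_set 0 j vu R2.
    have K3 : keeps k.+1 M2 (update M2 (loc v 0) j).
      by apply: keeps_update; rewrite ?vu.
    move: (update _ _ _) R3 K3 => M3 R3 K3.
    apply/does_seq/(does_conseq (IH1 _ _ _ fits1 (leqW uk) R3)) => M4 [R4 K4].
    apply/does_write; rewrite !(evalE (represents0 R4)).
    have K34 := keeps_trans K3 K4.
    rewrite K34 ?V2 ?addn1 ?uk ?leqnn //.
    have {}R4 : represents M4 (st j.+1).
      by rewrite /st -addn1 iotaD cats1 foldl_rcons.
    have K : keeps k M M4 by apply: keeps_trans K2 (keeps_le (leqnSn k) K34).
    by have [] := computed_update j.+1 ukW R4 K.
  + by move=> M2 [R2 _ V2]; rewrite !(evalE (represents0 R2)) V2 subnn.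
  + by move=> M2 [].
Qed.

End Compiler.

Lemma polytime_decidable_run (I : Type) (encode : I -> seq bool) (P : I -> Prop)
    (c : cmd) (u W ans : nat) :
  ans < u -> u <= W -> cfits u W c u ->
  (forall x, exists2 b : bool,
    run (encode x) c (fun _ _ => 0) ans 0 = b & b <-> P x) ->
  polytime_decidable encode P.
Proof.
move=> ansu uW fits dec.
(* Cell 0 holds the input length throughout the compiled code; only this last write replaces it by
   the answer. *)
pose p := Seq (ccomp W c u) (Write (Const 0) (Read (var ans))).
have [a [k pbound]] := time_bound_poly p; exists p, a, k => x.
have [b run_b bP] := dec x; set w := encode x in run_b *.
have R0 : represents u W w (input_memory w) (fun _ _ => 0).
  by split=> // b' i _; rewrite /loc addnS /= nth_default //; lia.
have [t [M [ex le_t Mb]]] : does (size w) p (input_memory w) (fun M => M 0 = b).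
  apply/does_seq/(does_conseq (ccomp_correct uW fits (leqnn u) R0)) => M [R _].
  apply/does_write; rewrite !(evalE W (represents0 R)).
  by rewrite /update /=; have [_ _ ->] := R.
by exists t, M, b; split=> //; apply: leq_trans le_t (pbound _).
Qed.

(** * Derived expressions *)

Definition EVar (v : nat) : exp := EGet v (ENum 0).
Definition ENot (a : exp) : exp := EIf a (ENum 0) (ENum 1).
Definition EAnd (a b : exp) : exp := EIf a (EIf b (ENum 1) (ENum 0)) (ENum 0).
Definition ELe (a b : exp) : exp := ENot (ESub a b).
Definition ELt (a b : exp) : exp := ENot (ELe b a).
Definition EEq (a b : exp) : exp := EAnd (ELe a b) (ELe b a).
Definition EOr (a b : exp) : exp := ENot (EAnd (ENot a) (ENot b)).
Definition ECount (v N : nat) (a : exp) : exp :=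
  ESum v (EAnd (ELt (EVar v) (EVar N)) a).
(** Repeated addition, faithful only while the first factor is at most the input length. *)
Definition EMul (v a b : nat) : exp :=
  ESum v (EIf (ELt (EVar v) (EVar a)) (EVar b) (ENum 0)).
(** The least solution equals the number of [q] with no solution up to [q]; without any solution
    this gives the input length. *)
Definition EFirst (q v : nat) (a : exp) : exp :=
  ESum q (ENot (ESum v (EAnd (ELe (EVar v) (EVar q)) a))).

Definition first (p : pred nat) (k : nat) : nat := find p (iota 0 k).

Lemma firstP p k :
  (first p k < k /\ p (first p k)) \/
  (first p k = k /\ forall j, j < k -> ~~ p j).
Proof.
rewrite /first; case hasp: (has p (iota 0 k)); [left|right].
  have lt := hasp; rewrite has_find size_iota in lt; split=> //.
  by have := nth_find 0 hasp; rewrite nth_iota.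
split; first by rewrite hasNfind ?hasp // size_iota.
by move=> j jk; apply: contraFN hasp => pj; apply/hasP; exists j; rewrite ?mem_iota.
Qed.

Lemma first_eq (p : pred nat) k j :
  j < k -> p j -> (forall i, i < j -> ~~ p i) -> first p k = j.
Proof.
move=> jk pj nop; have [[lt pf]|[_ /(_ _ jk)]] := firstP p k; last by rewrite pj.
apply/eqP; rewrite eqn_leq; apply/andP; split.
  rewrite leqNgt; apply/negP => jf.
  have := @before_find _ 0 p (iota 0 k) j jf.
  by rewrite nth_iota // pj.
by rewrite leqNgt; apply/negP => /nop; rewrite pf.
Qed.

Lemma first_sum (p : pred nat) k :
  \sum_(i < k) (\sum_(j < k) ((j <= i) && p j) == 0) = first p k.
Proof.
rewrite (eq_bigr (fun i : 'I_k => nat_of_bool (i < first p k))).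
  have le : first p k <= k by case: (firstP p k) => -[]; lia.
  rewrite -[RHS]card_ord -sum1_card (big_ord_widen _ (fun=> 1) le).
  by rewrite [RHS]big_mkcond; apply: eq_bigr => i _; case: ifP.
move=> i _; congr nat_of_bool; apply/eqP/idP => [/eqP|lt].
  rewrite sum_nat_eq0 => /forallP all0; rewrite ltnNge; apply/negP => le.
  have [[lt pf]|[ek _]] := firstP p k; last by have := ltn_ord i; lia.
  by have := all0 (Ordinal lt); rewrite /= le pf.
rewrite big1 // => j _; case ji: (j <= i) => //=.
have := @before_find _ 0 p (iota 0 k) j (leq_ltn_trans ji lt).
by rewrite nth_iota // add0n => ->.
Qed.

Section Macros.
Variable w : seq bool.
Implicit Types (a b : exp) (s : store).
Notation L := (size w).

Definition holds a s : bool := ev w a s != 0.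

Lemma ev_var v s : ev w (EVar v) s = s v 0. Proof. by []. Qed.

Lemma ev_sum v a s :
  ev w (ESum v a) s = \sum_(j < L) ev w a (set_entry s v 0 j).
Proof. by []. Qed.

Lemma ev_if a b e s :
  ev w (EIf a b e) s = if holds a s then ev w b s else ev w e s.
Proof. by []. Qed.

Lemma ev_add a b s : ev w (EAdd a b) s = ev w a s + ev w b s.
Proof. by []. Qed.

Lemma run_seq c1 c2 s : run w (CSeq c1 c2) s = run w c2 (run w c1 s).
Proof. by []. Qed.

Lemma run_if a c1 c2 s :
  run w (CIf a c1 c2) s = if holds a s then run w c1 s else run w c2 s.
Proof. by []. Qed.

Lemma ev_not a s : ev w (ENot a) s = ~~ holds a s.
Proof. by rewrite /= /holds; case: ifP. Qed.

Lemma ev_and a b s : ev w (EAnd a b) s = holds a s && holds b s.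
Proof. by rewrite /= /holds; case: (_ != 0); case: (_ != 0). Qed.

Lemma holds_not a s : holds (ENot a) s = ~~ holds a s.
Proof. by rewrite {1}/holds ev_not; case: holds. Qed.

Lemma holds_and a b s : holds (EAnd a b) s = holds a s && holds b s.
Proof. by rewrite {1}/holds ev_and; do 2 case: holds. Qed.

Lemma holds_or a b s : holds (EOr a b) s = holds a s || holds b s.
Proof. by rewrite holds_not holds_and !holds_not negb_and !negbK. Qed.

Lemma holds_le a b s : holds (ELe a b) s = (ev w a s <= ev w b s).
Proof. by rewrite holds_not /holds /= negbK subn_eq0. Qed.

Lemma holds_lt a b s : holds (ELt a b) s = (ev w a s < ev w b s).
Proof. by rewrite holds_not holds_le ltnNge. Qed.

Lemma holds_eq a b s : holds (EEq a b) s = (ev w a s == ev w b s).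
Proof. by rewrite holds_and !holds_le eqn_leq. Qed.

Lemma ev_eq a b s : ev w (EEq a b) s = (ev w a s == ev w b s).
Proof. by rewrite ev_and !holds_le eqn_leq. Qed.

Lemma ev_count v N a s :
  N != v -> s N 0 <= L ->
  ev w (ECount v N a) s = \sum_(j < s N 0) holds a (set_entry s v 0 j).
Proof.
move=> Nv NL.
rewrite (big_ord_widen L (fun j => nat_of_bool (holds a (set_entry s v 0 j)))) //.
rewrite big_mkcond ev_sum; apply: eq_bigr => j _.
rewrite ev_and holds_lt !ev_var /set_entry eqxx (negbTE Nv) /=.
by case: ifP.
Qed.

Lemma holds_count v N a s :
  N != v -> s N 0 <= L ->
  holds (ECount v N a) s =
  has (fun j => holds a (set_entry s v 0 j)) (iota 0 (s N 0)).
Proof.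
move=> Nv NL; rewrite {1}/holds ev_count // sum_nat_eq0 negb_forall.
apply/existsP/hasP => [[j]|[j]].
  by rewrite eqb0 negbK => aj; exists (j : nat); rewrite ?mem_iota ?add0n ?ltn_ord.
by rewrite mem_iota => /= jN aj; exists (Ordinal jN); rewrite aj.
Qed.

Lemma holds_bit a s : holds (EBit a) s = nth false w (ev w a s).
Proof. by rewrite /holds /=; case: nth. Qed.

Lemma ev_mul v x y s :
  x != v -> y != v -> s x 0 <= L -> ev w (EMul v x y) s = s x 0 * s y 0.
Proof.
move=> xv yv xL; rewrite -[in RHS](card_ord (s x 0)) -sum_nat_const.
rewrite (big_ord_widen L (fun=> s y 0)) // big_mkcond ev_sum.
apply: eq_bigr => j _.
by rewrite ev_if holds_lt !ev_var /set_entry eqxx (negbTE xv) (negbTE yv).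
Qed.

Lemma ev_first q v a s (p : pred nat) :
  q != v ->
  (forall i j, holds a (set_entry (set_entry s q 0 i) v 0 j) = p j) ->
  ev w (EFirst q v a) s = first p L.
Proof.
move=> qv ap; rewrite -first_sum ev_sum; apply: eq_bigr => i _.
rewrite ev_not /holds negbK ev_sum; congr (nat_of_bool (_ == 0)).
apply: eq_bigr => j _; rewrite ev_and ap holds_le !ev_var.
by rewrite /set_entry !eqxx (negbTE qv).
Qed.

End Macros.

(** * The decision procedure *)

(* vM, vC, vN hold m, c, n; vBase is where the bits of the orders start in the
   input; vMM holds m * m; vPlace and vLabel are the arrays of push-relabel. *)
Definition vM := 0.
Definition vC := 1.
Definition vN := 2.
Definition vBase := 3.
Definition vMM := 4.
Definition vD := 5.
Definition vT := 6.
Definition vK2 := 7.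
Definition vK3 := 8.
Definition vY := 9.
Definition vI := 10.
Definition vZ := 11.
Definition vAns := 12.
Definition vPlace := 13.
Definition vLabel := 14.

Definition CSkip : cmd := CSet vY (ENum 0) (EVar vY).

(* Tracks 15 to 18 are for the variables bound by EMul, ECount and EFirst. *)

Definition ordE (i x y : nat) : exp :=
  EBit (EAdd (EVar vBase) (EAdd (EMul 15 i vMM) (EAdd (EMul 15 x vM) (EVar y)))).
Definition maxE (i x : nat) : exp :=
  ENot (ECount 16 vM (EAnd (ordE i 16 x) (ENot (EEq (EVar 16) (EVar x))))).
Definition actE (i : nat) : exp :=
  EAnd (ENot (maxE i vC)) (ENot (EAnd (ordE i vD vC) (maxE i vD))).
Definition alE (i y : nat) : exp := EOr (EEq (EVar y) (EVar vC)) (maxE i y).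
(* Every active voter starts at c, which has capacity 0: being there means being
   unplaced, as c is never maximal for an active voter. *)
Definition capE (y : nat) : exp :=
  EIf (EEq (EVar y) (EVar vC)) (ENum 0)
      (EIf (EEq (EVar y) (EVar vD)) (EVar vK3) (EVar vT)).
Definition loadE (y : nat) : exp :=
  ECount 17 vN (EAnd (actE 17) (EEq (EGet vPlace (EVar 17)) (EVar y))).
Definition overE (y : nat) : exp :=
  EAnd (ELt (EVar y) (EVar vM)) (ELt (capE y) (loadE y)).

Definition downE (z : nat) : exp :=
  EAnd (alE vI z) (ELt (EGet vLabel (EVar z)) (EGet vLabel (EVar vY))).

Definition pick_voter : cmd :=
  CSet vI (ENum 0) (EFirst 18 vI
    (EAnd (ELt (EVar vI) (EVar vN))
    (EAnd (actE vI)
    (EAnd (EEq (EGet vPlace (EVar vI)) (EVar vY))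
          (ECount vZ vM (downE vZ)))))).

Definition push : cmd :=
  CSeq (CSet vZ (ENum 0) (EFirst 18 vZ (EAnd (ELt (EVar vZ) (EVar vM)) (downE vZ))))
       (CSet vPlace (EVar vI) (EVar vZ)).

Definition relabel : cmd :=
  CSet vLabel (EVar vY) (EAdd (EGet vLabel (EVar vY)) (ENum 1)).

(** A search that fails returns the input length, so the two tests against [ELen] detect that
    nothing is overloaded, and that no voter at the overloaded alternative can move to a smaller
    label. *)
Definition step : cmd :=
  CSeq (CSet vY (ENum 0) (EFirst 18 vY (overE vY)))
       (CIf (ELt (EVar vY) ELen)
            (CSeq pick_voter (CIf (ELt (EVar vI) ELen) push relabel))
            CSkip).

Definition slotsE : exp :=
  let count a := ECount 17 vN a in
  let k := EAdd (EVar vK2) (EVar vK3) in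
  let above := count (ordE 17 vD vC) in
  EAnd (ELe (EAdd (EAdd above k) (EAdd above k)) (EVar vN))
 (EAnd (ELe (EVar vK2) (count (EAnd (maxE 17 vC) (maxE 17 vD))))
 (EAnd (ELe (EVar vK3) (count (EAnd (ENot (maxE 17 vC))
                              (EAnd (ENot (ordE 17 vD vC)) (maxE 17 vD)))))
 (EAnd (ELe (EAdd (EVar vT) (EVar vK2)) (count (maxE 17 vC)))
       (ELe (EVar vT) (EAdd (count (EAnd (ordE 17 vD vC) (maxE 17 vD))) k))))).

Definition start : cmd :=
  CSeq (CFor vI (CSet vPlace (EVar vI) (EVar vC)))
       (CFor vY (CSet vLabel (EVar vY) (ENum 0))).

(* The three nested loops make L ^ 3 >= (n + 1) m ^ 2 steps. *)
Definition attempt : cmd :=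
  CIf (EAnd (ELt (EVar vD) (EVar vM)) (ENot (EEq (EVar vD) (EVar vC))))
      (CSeq start
      (CSeq (CFor vY (CFor vY (CFor vY step)))
            (CIf (EAnd slotsE (ENot (ECount vY vM (overE vY))))
                 (CSet vAns (ENum 0) (ENum 1))
                 CSkip)))
      CSkip.

Definition first_zero (a : exp) : exp := EFirst 18 16 (ENot (EBit (EAdd a (EVar 16)))).

Definition decode : cmd :=
  CSeq (CSet vM (ENum 0) (first_zero (ENum 0)))
 (CSeq (CSet vC (ENum 0) (first_zero (EAdd (EVar vM) (ENum 1))))
 (CSeq (CSet vN (ENum 0) (first_zero (EAdd (EVar vM) (EAdd (EVar vC) (ENum 2)))))
 (CSeq (CSet vBase (ENum 0) (EAdd (EVar vM) (EAdd (EVar vC) (EAdd (EVar vN) (ENum 3)))))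
       (CSet vMM (ENum 0) (EMul 15 vM vM))))).

(** [attempt] can only set [vAns] to 1, so the loops take the disjunction over all guesses, starting
    from the case of a single alternative. *)
Definition decide : cmd :=
  CSeq decode
 (CSeq (CSet vAns (ENum 0) (EEq (EVar vM) (ENum 1)))
       (CFor vD (CFor vT (CFor vK2 (CFor vK3 attempt))))).

(** The source tracks are numbered 0 to 18; the bound 60 only has to leave enough scratch tracks for
    the nesting depth. *)
Lemma decide_fits : cfits 20 60 decide 20.
Proof. by vm_compute. Qed.

(** * Correctness of the procedure on numbered alternatives and voters *)

Section Correctness.
Variables (w : seq bool) (m c n : nat).
Notation L := (size w).
Hypotheses (mL : m <= L) (nL : n <= L) (cm : c < m).
(** The 3 counts the terminators of the three unary numbers. *)
Definition base := m + (c + (n + 3)).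
Definition order (i x y : nat) : bool :=
  nth false w (base + (i * (m * m) + (x * m + y))).
Definition max_at (i x : nat) : bool :=
  ~~ has (fun y => order i y x && (y != x)) (iota 0 m).

Section Attempt.
Variables (d T k2 k3 : nat).

Definition act (i : nat) : bool := ~~ max_at i c && ~~ (order i d c && max_at i d).
Definition al (i y : nat) : bool := (y == c) || max_at i y.
Definition cap (y : nat) : nat := if y == c then 0 else if y == d then k3 else T.
Definition good_slots : bool :=
  let count p := \sum_(i < n) nat_of_bool (p (i : nat)) in
  let k := k2 + k3 in
  let above := count (fun i => order i d c) in
  [&& above + k + (above + k) <= n,
      k2 <= count (fun i => max_at i c && max_at i d),
      k3 <= count (fun i => [&& ~~ max_at i c, ~~ order i d c & max_at i d]),
      T + k2 <= count (fun i => max_at i c)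
    & T <= count (fun i => order i d c && max_at i d) + k].

(** All that an attempt writes lies in tracks from 9 on, so these entries are constant during it. *)
Definition frame (s : store) : Prop :=
  forall v, v < 9 -> s v 0 = nth 0 [:: m; c; n; base; m * m; d; T; k2; k3] v.

Lemma frame_set s a i x : 9 <= a -> frame s -> frame (set_entry s a i x).
Proof. by move=> a9 Fs v v9; rewrite /set_entry ifN ?Fs //; lia. Qed.

Lemma set_entry_neq s a i x b j : b != a -> set_entry s a i x b j = s b j.
Proof. by move=> /negbTE ba; rewrite /set_entry ba. Qed.

Lemma holds_ord i x y s :
  i != 15 -> x != 15 -> frame s -> s i 0 <= L -> s x 0 <= L ->
  holds w (ordE i x y) s = order (s i 0) (s x 0) (s y 0).
Proof.
move=> i15 x15 Fs iL xL; rewrite holds_bit.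
by rewrite !ev_add !ev_var !ev_mul // (Fs vBase) // (Fs vMM) // (Fs vM).
Qed.

Lemma holds_max i x s :
  i != 15 -> i != 16 -> x != 16 -> frame s -> s i 0 <= L ->
  holds w (maxE i x) s = max_at (s i 0) (s x 0).
Proof.
move=> i15 i16 x16 Fs iL; rewrite holds_not holds_count ?(Fs vM) //.
congr (~~ _); apply: eq_in_has => y; rewrite mem_iota => /= ym.
have Fy := @frame_set s 16 0 y isT Fs.
have yL : y <= L by apply: leq_trans mL; apply: ltnW.
have [Ei Ex] := (set_entry_neq s 0 y 0 i16, set_entry_neq s 0 y 0 x16).
by rewrite holds_and holds_ord ?Ei // holds_not holds_eq !ev_var Ex.
Qed.

Lemma holds_al i y s :
  i != 15 -> i != 16 -> y != 16 -> frame s -> s i 0 <= L ->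
  holds w (alE i y) s = al (s i 0) (s y 0).
Proof.
move=> i15 i16 y16 Fs iL.
by rewrite holds_or holds_eq holds_max // !ev_var (Fs vC).
Qed.

Lemma ev_cap y s : frame s -> ev w (capE y) s = cap (s y 0).
Proof.
move=> Fs; rewrite !ev_if !holds_eq !ev_var.
by rewrite (Fs vC) // (Fs vD) // (Fs vK3) // (Fs vT).
Qed.

Hypotheses (dm : d < m).

Lemma holds_act i s :
  i != 15 -> i != 16 -> frame s -> s i 0 <= L -> holds w (actE i) s = act (s i 0).
Proof.
move=> i15 i16 Fs iL.
have dL : s vD 0 <= L by rewrite (Fs vD) // ltnW // (leq_trans dm).
rewrite holds_and holds_not holds_max // holds_not holds_and holds_ord //.
by rewrite holds_max // (Fs vD) // (Fs vC).
Qed.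

Lemma ev_load y s :
  y != 17 -> frame s -> ev w (loadE y) s = load n act (s vPlace) (s y 0).
Proof.
move=> y17 Fs; rewrite ev_count ?(Fs vN) // /load [RHS]big_mkcond.
apply: eq_bigr => i _; have Fi := @frame_set s 17 0 i isT Fs.
have iL : i <= L by apply: leq_trans nL; apply: ltnW.
rewrite holds_and holds_act // holds_eq ev_var (set_entry_neq s 0 i 0 y17).
rewrite -[ev w (EGet _ _) _]/(s vPlace i).
by case: (act _).
Qed.

Lemma holds_over y s :
  y != 17 -> frame s ->
  holds w (overE y) s = overloaded n m act cap (s vPlace) (s y 0).
Proof.
move=> y17 Fs; rewrite holds_and !holds_lt ev_cap // ev_load // ev_var.
by rewrite ev_var (Fs vM).
Qed.

(** Each search is identified with [first] of a predicate; [firstP] then splits into the idle,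
    relabel and push moves, each of which advances a preflow by one step. *)
Lemma run_step s t :
  frame s -> preflow n m act al cap t (s vPlace) (s vLabel) ->
  preflow n m act al cap t.+1 (run w step s vPlace) (run w step s vLabel).
Proof.
move=> Fs pre.
pose p1 := overloaded n m act cap (s vPlace).
pose y := first p1 L.
pose s1 := set_entry s vY 0 y.
have Fs1 : frame s1 by apply: frame_set.
have E1 : run w (CSet vY (ENum 0) (EFirst 18 vY (overE vY))) s = s1.
  apply: (congr1 (set_entry s vY 0)).
  by apply: ev_first => // i j; rewrite holds_over //; do 2! apply: frame_set => //.
rewrite /step run_seq E1 run_if holds_lt.
rewrite -[ev w (EVar vY) s1]/y -[ev w ELen s1]/L.
have := firstP p1 L; rewrite -/y => -[[yL ov]|[-> no]]; last first.
  rewrite ltnn -/run; apply: preflow_stop => // z.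
  have [/no //|Lz] := ltnP z L.
  by rewrite /overloaded ltnNge (leq_trans mL Lz).
rewrite yL -/run.
pose down i z := al i z && (s vLabel z < s vLabel y).
pose p2 i := [&& i < n, act i, s vPlace i == y & has (down i) (iota 0 m)].
pose i := first p2 L.
pose s2 := set_entry s1 vI 0 i.
have Fs2 : frame s2 by apply: frame_set.
have Edown s' j z : frame s' -> j <= L -> s' vI 0 = j -> s' vZ 0 = z ->
    s' vY 0 = y -> s' vLabel =1 s vLabel -> holds w (downE vZ) s' = down j z.
  move=> Fs' jL Ej Ez Ey Eh; rewrite holds_and holds_lt holds_al ?Ej ?Ez //.
  by rewrite -![ev w (EGet vLabel (EVar _)) s']/(s' vLabel (s' _ 0)) Ey Ez !Eh.
have E2 : run w pick_voter s1 = s2.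
  apply: (congr1 (set_entry s1 vI 0)).
  apply: ev_first => // q j; set s' := set_entry _ vI 0 j.
  have Fs' : frame s' by do 2! apply: frame_set => //.
  rewrite /p2 holds_and holds_lt !ev_var (Fs' vN) //.
  rewrite -[s' vI 0]/j; case: (ltnP j n) => //= jn.
  have jL : j <= L by apply: leq_trans nL; apply: ltnW.
  rewrite holds_and holds_act // holds_and holds_eq.
  rewrite -[ev w (EVar vY) s']/y -[ev w (EGet _ _) s']/(s vPlace j).
  congr [&& _, _ & _]; rewrite holds_count ?(Fs' vM) //.
  apply: eq_has => z; apply: Edown => //; exact: frame_set.
rewrite run_seq E2 run_if holds_lt.
rewrite -[ev w (EVar vI) s2]/i -[ev w ELen s2]/L.
have := firstP p2 L; rewrite -/i => -[[iL]|[-> no2]]; last first.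
  rewrite ltnn -/run -[run w relabel s2]/(set_entry s2 vLabel y (s vLabel y + 1)).
  rewrite addn1 -/(upd (s vLabel) y (s vLabel y).+1).
  apply: (@preflow_relabel n m act al cap t (s vPlace) (s vLabel) y) => //.
  move=> j z jn actj fj zm aljz.
  have := no2 j (leq_trans jn nL); rewrite /p2 jn actj fj eqxx /=.
  by move=> /hasPn/(_ z); rewrite mem_iota zm /down aljz /= -leqNgt; apply.
rewrite iL -/run => /and4P[lin acti /eqP fi hasd].
have iL' : i <= L by apply: ltnW.
pose p3 z := (z < m) && down i z.
pose z := first p3 L.
have E3 : run w (CSet vZ (ENum 0)
    (EFirst 18 vZ (EAnd (ELt (EVar vZ) (EVar vM)) (downE vZ)))) s2 = set_entry s2 vZ 0 z.
  apply: (congr1 (set_entry s2 vZ 0)).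
  apply: ev_first => // q j; set s' := set_entry _ vZ 0 j.
  have Fs' : frame s' by do 2! apply: frame_set => //.
  rewrite holds_and holds_lt !ev_var (Fs' vM) //.
  by congr (_ && _); apply: Edown.
rewrite /push run_seq E3.
(* This search cannot fail: the voter was chosen so as to have a target of smaller label. *)
have := firstP p3 L; rewrite -/z => -[[zL /and3P[zm aliz hz]]|[_ no3]]; last first.
  have /hasP[z0] := hasd; rewrite mem_iota => /= z0m dz0.
  by have := no3 z0 (leq_trans z0m mL); rewrite /p3 z0m dz0.
apply: (@preflow_push n m act al cap t (s vPlace) (s vLabel) i z) => //.
  by rewrite fi.
by rewrite fi.
Qed.

Lemma frame_run body s : all (leq 9) (writes body) -> frame s -> frame (run w body s).
Proof.
move=> /allP wr Fs v v9; rewrite run_frame ?Fs //.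
by apply/negP => /wr; rewrite leqNgt v9.
Qed.

(** Stated for a body worth [q] steps, so that it applies again to each enclosing loop. *)
Lemma run_steps (body : cmd) q :
  all (leq 9) (writes body) ->
  (forall s t, frame s -> preflow n m act al cap t (s vPlace) (s vLabel) ->
    preflow n m act al cap (t + q) (run w body s vPlace) (run w body s vLabel)) ->
  forall s t, frame s -> preflow n m act al cap t (s vPlace) (s vLabel) ->
    preflow n m act al cap (t + L * q)
      (run w (CFor vY body) s vPlace) (run w (CFor vY body) s vLabel).
Proof.
move=> wr step_q s t Fs pre.
pose Inv j s' := frame s' /\
  preflow n m act al cap (t + j * q) (s' vPlace) (s' vLabel).
suff [] : Inv L (run w (CFor vY body) s) by [].
apply: run_for_ind => [|j s' jL [Fs' pre']]; first by rewrite /Inv mul0n addn0.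
have Fj := @frame_set s' vY 0 j isT Fs'; split; first exact: frame_run.
by rewrite mulSn [q + _]addnC addnA; apply: step_q.
Qed.

Lemma run_start s :
  frame s -> frame (run w start s) /\
    preflow n m act al cap 0 (run w start s vPlace) (run w start s vLabel).
Proof.
move=> Fs; rewrite run_seq; set s1 := run w (CFor vI _) s.
have [Fs1 place] : frame s1 /\ forall i, i < L -> s1 vPlace i = c.
  apply: (run_for_ind (Inv := fun j s' => frame s' /\
    forall i, i < j -> s' vPlace i = c)) => // j s' jL [Fs' IH].
  split; first by apply: frame_run => //; apply: frame_set.
  move=> i; rewrite ltnS leq_eqVlt /= => ij.
  rewrite -[LHS]/(if i == j then s' vC 0 else s' vPlace i).
  by case: eqP ij => [_ _|_ /IH //]; rewrite (Fs' vC).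
set s2 := run w _ s1.
have [Fs2 [label place2]] : frame s2 /\
    ((forall y, y < L -> s2 vLabel y = 0) /\ s2 vPlace =1 s1 vPlace).
  apply: (run_for_ind (Inv := fun j s' => frame s' /\
    ((forall y, y < j -> s' vLabel y = 0) /\ s' vPlace =1 s1 vPlace)))
    => // j s' jL [Fs' [IH IH']].
  split; first by apply: frame_run => //; apply: frame_set.
  split=> // y; rewrite ltnS leq_eqVlt /= => yj.
  rewrite -[LHS]/(if y == j then 0 else s' vLabel y).
  by case: eqP yj => [_ _|_ /IH].
split=> //; apply: (@preflow_start n m act al cap c) => //.
- by move=> i; rewrite /al eqxx.
- by move=> i lin; rewrite place2 place // (leq_trans lin).
- by move=> y ym; rewrite label // (leq_trans ym).
Qed.

Lemma ev_count_voters a (p : pred nat) s :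
  frame s -> (forall i, i <= L -> holds w a (set_entry s 17 0 i) = p i) ->
  ev w (ECount 17 vN a) s = \sum_(i < n) p i.
Proof.
move=> Fs ap; rewrite ev_count ?(Fs vN) //; apply: eq_bigr => i _.
by rewrite ap // (leq_trans _ nL) // ltnW.
Qed.

Lemma holds_slots s : frame s -> holds w slotsE s = good_slots.
Proof.
move=> Fs; have F i := @frame_set s 17 0 i isT Fs.
have dL : d <= L by apply: leq_trans mL; apply: ltnW.
have ord i : i <= L -> holds w (ordE 17 vD vC) (set_entry s 17 0 i) = order i d c.
  by move=> iL; rewrite holds_ord ?(F i vD) // ?(F i vC).
have maxc i : i <= L -> holds w (maxE 17 vC) (set_entry s 17 0 i) = max_at i c.
  by move=> iL; rewrite holds_max ?(F i vC).
have maxd i : i <= L -> holds w (maxE 17 vD) (set_entry s 17 0 i) = max_at i d.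
  by move=> iL; rewrite holds_max ?(F i vD).
rewrite /slotsE 4!holds_and !holds_le.
have c1 := ev_count_voters Fs ord.
have c2 := ev_count_voters Fs maxc.
have both i : i <= L ->
    holds w (EAnd (maxE 17 vC) (maxE 17 vD)) (set_entry s 17 0 i) =
    max_at i c && max_at i d.
  by move=> iL; rewrite holds_and maxc ?maxd.
have swing i : i <= L ->
    holds w (EAnd (ENot (maxE 17 vC)) (EAnd (ENot (ordE 17 vD vC)) (maxE 17 vD)))
      (set_entry s 17 0 i) =
    [&& ~~ max_at i c, ~~ order i d c & max_at i d].
  by move=> iL; rewrite holds_and holds_not maxc // holds_and holds_not ord // maxd.
have above i : i <= L ->
    holds w (EAnd (ordE 17 vD vC) (maxE 17 vD)) (set_entry s 17 0 i) =
    order i d c && max_at i d.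
  by move=> iL; rewrite holds_and ord ?maxd.
have [c3 c4 c5] := And3 (ev_count_voters Fs both) (ev_count_voters Fs swing)
  (ev_count_voters Fs above).
by rewrite !ev_add c1 c2 c3 c4 c5 !ev_var (Fs vN) // (Fs vK2) // (Fs vK3) // (Fs vT).
Qed.

End Attempt.

Hypothesis nL' : n < L.

(** A specification of commands that join a condition disjunctively to the answer; under loops it
    turns into an existential quantifier. *)
Definition adds (body : cmd) (s : store) (P : Prop) : Prop :=
  forall b : bool, s vAns 0 = b ->
    exists2 b' : bool, run w body s vAns 0 = b' & b' <-> b \/ P.

Definition valid (d T k2 k3 : nat) : Prop :=
  [/\ d < m, d != c, good_slots d T k2 k3
    & feasible n m (act d) al (cap d T k3)].

Lemma run_attempt d T k2 k3 s :
  frame d T k2 k3 s -> adds attempt s (valid d T k2 k3).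
Proof.
move=> Fs b sb; rewrite /attempt run_if holds_and holds_lt holds_not holds_eq !ev_var.
rewrite (Fs vD) // (Fs vM) // (Fs vC) //.
rewrite -[nth _ _ vD]/d -[nth _ _ vM]/m -[nth _ _ vC]/c.
case: ifPn => [/andP[dm dc]|nv]; last first.
  by exists b; rewrite // /valid; split; [left|case=> // -[dm dc]; rewrite dm dc in nv].
rewrite !run_seq; have [Fs1 pre1] := run_start Fs.
set s1 := run w start s in Fs1 pre1 *.
set s2 := run w _ s1.
have Fs2 : frame d T k2 k3 s2 by apply: frame_run.
have pre2 : preflow n m (act d) al (cap d T k3) (0 + L * (L * (L * 1)))
    (s2 vPlace) (s2 vLabel).
  apply: run_steps Fs1 pre1 => // sa ta Fa pa.
  apply: run_steps Fa pa => // s3 tb Fb pb.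
  apply: run_steps Fb pb => // sc tc Fc pc.
  rewrite addn1; exact: (run_step dm Fc pc).
have m0 : 0 < m by apply: leq_ltn_trans cm.
(* The strict bound n < L pays for the factor n + 1. *)
have big : n.+1 * m * m <= 0 + L * (L * (L * 1)).
  by rewrite muln1 add0n mulnA !leq_mul.
have dec := preflow_decides m0 big pre2.
have noover : ~~ holds w (ECount vY vM (overE vY)) s2 <->
    feasible n m (act d) al (cap d T k3).
  rewrite -dec holds_count ?(Fs2 vM) //.
  have E y : holds w (overE vY) (set_entry s2 vY 0 y) =
             overloaded n m (act d) (cap d T k3) (s2 vPlace) y.
    have Fy := @frame_set d T k2 k3 s2 vY 0 y isT Fs2.
    by rewrite (@holds_over _ _ _ _ dm vY _ isT Fy).
  rewrite (eq_has E); split=> [/hasPn no y|no].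
    have [ym|my] := ltnP y m; first by apply: no; rewrite mem_iota.
    by rewrite /overloaded ltnNge my.
  by apply/hasPn => y _; apply: no.
have s2b : s2 vAns 0 = b by rewrite /s2 run_frame // /s1 run_frame.
rewrite run_if holds_and holds_not (holds_slots dm Fs2).
case: ifPn => [/andP[gs no]|nv].
  by exists true => //; split=> // _; right; split=> //; apply/noover.
exists b; first exact: s2b.
split; first by left.
by case=> // -[_ _ gs /noover no]; rewrite gs no in nv.
Qed.

Lemma adds_for v body s (P : nat -> Prop) :
  v != vAns ->
  (forall j s', j < L -> (forall a, a \notin v :: writes body -> s' a 0 = s a 0) ->
    adds body (set_entry s' v 0 j) (P j)) ->
  adds (CFor v body) s (exists2 j, j < L & P j).
Proof.
move=> vA step_j b sb.
pose Inv k s' := (forall a, a \notin v :: writes body -> s' a 0 = s a 0) /\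
  exists2 b' : bool, s' vAns 0 = b' & b' <-> b \/ exists2 j, j < k & P j.
suff [_ [b' ? bP]] : Inv L (run w (CFor v body) s) by exists b'.
apply: run_for_ind => [|k s' kL [same [b' s'b bP]]].
  by split=> //; exists b => //; split; [left|case=> // -[]].
split=> [a|].
  rewrite inE negb_or => /andP[av na]; rewrite run_frame //.
  by rewrite set_entry_neq // same // inE negb_or av.
have [|b'' rb bP'] := step_j k s' kL same b'.
  by rewrite set_entry_neq // eq_sym.
exists b'' => //; rewrite bP' bP; split.
  case=> [[|[j jk Pj]]|Pk]; [by left| |by right; exists k].
  by right; exists j; rewrite // ltnS ltnW.
case=> [|[j]]; first by left; left.
rewrite ltnS leq_eqVlt => /orP[/eqP->|jk] Pj; first by right.
by left; right; exists j.
Qed.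

Lemma run_attempts s :
  (forall v, v < 5 -> s v 0 = nth 0 [:: m; c; n; base; m * m] v) ->
  adds (CFor vD (CFor vT (CFor vK2 (CFor vK3 attempt)))) s
    (exists2 d, d < L & exists2 T, T < L & exists2 k2, k2 < L &
     exists2 k3, k3 < L & valid d T k2 k3).
Proof.
move=> base_s; apply: adds_for => // d s1 dL E1.
apply: adds_for => // T s2 TL E2; apply: adds_for => // k2 s3 k2L E3.
apply: adds_for => // k3 s4 k3L E4; apply: run_attempt.
have low v : v < 5 -> set_entry s4 vK3 0 k3 v 0 = s v 0.
  move=> v5; have [n1 n2 n3 n4] : [/\ v != vD, v != vT, v != vK2 & v != vK3].
    by rewrite /vD /vT /vK2 /vK3; split; apply/eqP; lia.
  have nin l : all (fun a => 4 < a) l -> v \notin l.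
    by move/allP => nw; apply/negP => /nw; rewrite ltnNge -ltnS v5.
  rewrite set_entry_neq // E4 ?nin // set_entry_neq // E3 ?nin //.
  by rewrite set_entry_neq // E2 ?nin // set_entry_neq // E1 ?nin.
move=> v; have [v5|] := ltnP v 5.
  by rewrite low // base_s //; case: v v5 => [|[|[|[|[|v]]]]].
case: v => [|[|[|[|[|v]]]]] // _.
case: v => [_|v].
  by rewrite set_entry_neq // E4 // set_entry_neq // E3 // set_entry_neq // E2.
case: v => [_|v]; first by rewrite set_entry_neq // E4 // set_entry_neq // E3.
case: v => [_|v]; first by rewrite set_entry_neq // E4.
by case: v.
Qed.

End Correctness.

(** * From the encoded input back to the instance *)

Section Encoding.

Lemma nth_flatten_uniform (A : Type) (x0 : A) k (ss : seq (seq A)) i j :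
  all (fun s => size s == k) ss -> i < size ss -> j < k ->
  nth x0 (flatten ss) (i * k + j) = nth x0 (nth [::] ss i) j.
Proof.
elim: ss i => // s ss IH [|i] /= /andP[/eqP sk all_k] ilt jk; rewrite nth_cat sk.
  by rewrite mul0n add0n jk.
by rewrite mulSn -addnA ltnNge leq_addr /= addKn IH.
Qed.

Lemma size_unary k : size (unary k) = k.+1.
Proof. by rewrite size_rcons size_nseq. Qed.

(** With the prefix [p] already read, the next number is the offset of its terminating [false]. *)
Lemma first_unary p k r w :
  w = p ++ unary k ++ r ->
  first (fun j => ~~ nth false w (size p + j)) (size w) = k.
Proof.
have nthE j : j <= k -> nth false (p ++ unary k ++ r) (size p + j) = (j < k).
  move=> jk; rewrite nth_cat ltnNge leq_addr /= addKn nth_cat size_unary ltnS jk.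
  by rewrite nth_rcons size_nseq nth_nseq; case: ltngtP jk.
move=> ->; apply: first_eq => [||i ik].
- by rewrite !size_cat size_unary; lia.
- by rewrite nthE // ltnn.
- by rewrite nthE ?ik // ltnW.
Qed.

Variable I : instance.
Notation C := (alternatives I).
Notation Q := (posets I).
Notation n := (voters I).
Notation m := #|C|.
Notation c := (enum_rank (candidate I) : nat).
Notation w := (encode_instance I).
Notation rank x := (nat_of_ord (enum_rank x)).

Lemma size_poset_bits (O : poset C) : size (poset_bits O) = m * m.
Proof. by rewrite size_allpairs -cardE. Qed.

Lemma nth_poset_bits (O : poset C) x y :
  nth false (poset_bits O) (rank x * m + rank y) = O x y.
Proof.
have sE : size (enum C) = m by rewrite -cardE.
have [rx ry] := (ltn_ord (enum_rank x), ltn_ord (enum_rank y)).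
rewrite nth_flatten_uniform ?size_map ?sE //.
  by rewrite (nth_map x) ?sE // (nth_map y) ?sE // !nth_enum_rank.
  by apply/allP => s /mapP[z _ ->]; rewrite size_map sE.
by rewrite -enumT sE.
Qed.

Lemma size_encode : size w = m + c + n + 3 + n * (m * m).
Proof.
rewrite !size_cat !size_unary size_flatten.
have -> : shape [seq poset_bits (Q i) | i <- enum 'I_n] = nseq n (m * m).
  rewrite -[n in nseq n](size_enum_ord n).
  rewrite -(size_map (fun i => size (poset_bits (Q i)))) /shape -map_comp.
  by apply/all_pred1P/allP => _ /mapP[i _ ->] /=; rewrite size_poset_bits.
by rewrite sumn_nseq; lia.
Qed.

Lemma candidate_lt : c < m. Proof. by []. Qed.

Lemma order_encode (i : 'I_n) x y : order w m c n i (rank x) (rank y) = Q i x y.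
Proof.
rewrite /order /base /encode_instance !catA nth_cat !size_cat !size_unary.
rewrite ltnNge [_ <= _](_ : _ = true) /=; last by lia.
have skip a b e f : a + (b + (e + 3)) + f - (a.+1 + b.+1 + e.+1) = f by lia.
rewrite skip.
have lt : rank x * m + rank y < m * m.
  have digits a b e : a < e -> b < e -> a * e + b < e * e by nia.
  exact: digits (ltn_ord _) (ltn_ord _).
rewrite nth_flatten_uniform ?size_map //; last first.
  by rewrite -enumT size_enum_ord.
  by apply/allP => s /mapP[z _ ->]; rewrite size_poset_bits.
rewrite (nth_map i) ?size_enum_ord // nth_ord_enum.
exact: nth_poset_bits.
Qed.

Lemma rank_onto z : z < m -> exists x : C, z = rank x.
Proof. by move=> zm; exists (enum_val (Ordinal zm)); rewrite enum_valK. Qed.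

Lemma max_at_encode (i : 'I_n) x : max_at w m c n i (rank x) = maximal (Q i) x.
Proof.
apply/hasPn/maximalP => [h y yx|h z].
  have := h (rank y); rewrite mem_iota order_encode yx /= => /(_ (ltn_ord _)).
  by rewrite negbK => /eqP/val_inj/enum_rank_inj.
rewrite mem_iota => /rank_onto[y ->]; rewrite order_encode.
by apply/negP => /andP[/h -> ]; rewrite eqxx.
Qed.

Lemma sum_bool_card N (p : 'I_N -> bool) : \sum_(i < N) p i = #|[set i | p i]|.
Proof.
by rewrite -sum1dep_card [RHS]big_mkcond; apply: eq_bigr => i _; case: (p i).
Qed.

Lemma good_slotsP d T k2 k3 :
  reflect (slots Q (candidate I) d T k2 k3) (good_slots w m c n (rank d) T k2 k3).
Proof.
have ord (i : 'I_n) : order w m c n i (rank d) c = Q i d (candidate I).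
  exact: order_encode.
have maxc (i : 'I_n) : max_at w m c n i c = maximal (Q i) (candidate I).
  exact: max_at_encode.
have maxd (i : 'I_n) := max_at_encode i d.
rewrite /good_slots !sum_bool_card.
have -> : [set i : 'I_n | order w m c n i (rank d) c] =
          above Q (candidate I) d.
  by apply/setP => i; rewrite !inE ord.
have -> : [set i : 'I_n | max_at w m c n i c && max_at w m c n i (rank d)] =
          both_max Q (candidate I) d.
  by apply/setP => i; rewrite !inE maxc maxd.
have -> : [set i : 'I_n | [&& ~~ max_at w m c n i c,
      ~~ order w m c n i (rank d) c & max_at w m c n i (rank d)]] =
          swing Q (candidate I) d.
  by apply/setP => i; rewrite !inE maxc maxd ord.
have -> : [set i : 'I_n | max_at w m c n i c] = c_max Q (candidate I).
  by apply/setP => i; rewrite !inE maxc.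
have -> : [set i : 'I_n | order w m c n i (rank d) c && max_at w m c n i (rank d)] =
          above_max Q (candidate I) d.
  by apply/setP => i; rewrite !inE maxd ord.
rewrite addnn addnA.
by apply: (iffP and5P) => -[h1 h2 h3 h4 h5]; split; rewrite // ?addnA // -addnA.
Qed.

Lemma act_encode (d : C) (i : 'I_n) :
  act w m c n (rank d) i = (i \in active Q (candidate I) d).
Proof. by rewrite inE /act !max_at_encode order_encode. Qed.

Lemma load_encode (d : C) (f : nat -> nat) (g : 'I_n -> C) y :
  (forall i : 'I_n, i \in active Q (candidate I) d -> f i = rank (g i)) ->
  load n (act w m c n (rank d)) f (rank y) =
  #|[set i in active Q (candidate I) d | g i == y]|.
Proof.
move=> fg; rewrite -sum_bool_card /load big_mkcond; apply: eq_bigr => i _.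
rewrite act_encode; case: ifP => //= /fg ->.
by rewrite (inj_eq val_inj) (inj_eq enum_rank_inj).
Qed.

(** The flow problem additionally allows everyone at [c], but with capacity 0. So a feasible flow
    never uses this permission, and conversely a placement puts no active voter at [c], which is not
    maximal for any of them. *)
Lemma feasible_encode (d : C) T k3 :
  d != candidate I ->
  feasible n m (act w m c n (rank d)) (al w m c n) (cap c (rank d) T k3) <->
  exists g, placement Q (candidate I) d T k3 g.
Proof.
set A := active Q (candidate I) d => dc.
have rank_eq (x y : C) : (rank x == rank y) = (x == y).
  by rewrite (inj_eq val_inj) (inj_eq enum_rank_inj).
split=> [[f [fal fcap]]|[g [gmax gd gT]]].
  pose g (i : 'I_n) := nth (candidate I) (enum C) (f i).
  have fg i : i \in A -> f i = rank (g i).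
    rewrite -act_encode => acti; have [fm _] := fal i (ltn_ord i) acti.
    by rewrite /g -[f i]/(nat_of_ord (Ordinal fm)) -enum_val_nth enum_valK.
  have loadE y : #|[set i in A | g i == y]| <= cap c (rank d) T k3 (rank y).
    by rewrite -(load_encode y fg); apply: fcap.
  have gc i : i \in A -> g i != candidate I.
    move=> iA; apply/negP => gic; have := loadE (candidate I).
    rewrite /cap eqxx leqn0 cards_eq0 => /eqP/setP/(_ i).
    by rewrite !inE gic andbT; move: iA; rewrite inE => ->.
  exists g; split=> [i iA||y yc yd].
  - have := fal i (ltn_ord i); rewrite act_encode => /(_ iA)[_].
    by rewrite /al fg // rank_eq (negbTE (gc i iA)) max_at_encode.
  - by have := loadE d; rewrite /cap rank_eq (negbTE dc) eqxx.
  - by have := loadE y; rewrite /cap !rank_eq (negbTE yc) (negbTE yd).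
(* The default 0 is taken only at numbers that are not voters. *)
pose f k := oapp (fun i => rank (g i)) 0 (insub k).
have fg i : i \in A -> f i = rank (g i) by rewrite /f valK.
exists f; split=> [k kn|k km].
  rewrite -[k]/(nat_of_ord (Ordinal kn)) act_encode => iA; rewrite fg //.
  by split=> //; rewrite /al max_at_encode gmax ?orbT.
have [y ->] := rank_onto km; rewrite (load_encode y fg) /cap !rank_eq.
case: eqP => [->|/eqP yc]; last by case: eqP => [->|/eqP yd] //; apply: gT.
rewrite leqn0 cards_eq0; apply/eqP/setP => i; rewrite in_set0 in_set.
apply/negP => /andP[iA /eqP gic]; move: (gmax i iA); rewrite gic.
by move: iA; rewrite inE => /andP[/negbTE ->].
Qed.

Lemma run_decode v : v < 5 ->
  run w decode (fun _ _ => 0) v 0 = nth 0 [:: m; c; n; base m c n; m * m] v.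
Proof.
have mw : m <= size w by rewrite size_encode; lia.
pose s0 : store := fun _ _ => 0.
have fz a s p k r : ev w a s = size p ->
    (forall i j, ev w a (set_entry (set_entry s 18 0 i) 16 0 j) = ev w a s) ->
    w = p ++ unary k ++ r -> ev w (first_zero a) s = k.
  move=> ap aE ww; rewrite -(first_unary ww); apply: ev_first => // i j.
  by rewrite holds_not holds_bit ev_add aE ap.
pose s1 := set_entry s0 vM 0 m.
pose s2 := set_entry s1 vC 0 c.
pose s3 := set_entry s2 vN 0 n.
pose s4 := set_entry s3 vBase 0 (base m c n).
pose s5 := set_entry s4 vMM 0 (m * m).
suff -> : run w decode s0 = s5 by case: v => [|[|[|[|[|]]]]].
rewrite /decode !run_seq.
have -> : run w (CSet vM (ENum 0) (first_zero (ENum 0))) s0 = s1.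
  apply: (congr1 (set_entry s0 vM 0)).
  exact: (fz _ _ [::] _ _ _ _ erefl).
have -> : run w (CSet vC (ENum 0) (first_zero (EAdd (EVar vM) (ENum 1)))) s1 = s2.
  apply: (congr1 (set_entry s1 vC 0)).
  apply: (fz _ _ (unary m) _ _ _ _ erefl) => //.
  by rewrite ev_add size_unary ev_var addn1.
have -> : run w (CSet vN (ENum 0)
    (first_zero (EAdd (EVar vM) (EAdd (EVar vC) (ENum 2))))) s2 = s3.
  apply: (congr1 (set_entry s2 vN 0)).
  apply: (fz _ _ (unary m ++ unary c) _ _ _ _ _) => //; last by rewrite -catA.
  rewrite !ev_add size_cat !size_unary !ev_var.
  by rewrite -[ev w (ENum 2) s2]/2 -[s2 vM 0]/m -[s2 vC 0]/c; lia.
rewrite -[run w (CSet vBase _ _) s3]/s4.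
apply: (congr1 (set_entry s4 vMM 0)).
exact: ev_mul.
Qed.

Lemma decide_correct : exists2 b : bool,
  run w decide (fun _ _ => 0) vAns 0 = b &
  b <-> possible_cowinner plurality_runoff Q (candidate I).
Proof.
have sw := size_encode.
have mL : m <= size w by lia.
have nL : n < size w by lia.
rewrite /decide 2!run_seq; set s0 := run w decode _.
have s0E : forall v, v < 5 -> s0 v 0 = _ := run_decode.
set s1 := run w _ s0.
have s1E v : v < 5 -> s1 v 0 = nth 0 [:: m; c; n; base m c n; m * m] v.
  move=> v5; rewrite -s0E // /s1 run_frame //= inE.
  by apply/eqP => vA; rewrite vA in v5.
have s1A : s1 vAns 0 = (m == 1).
  by rewrite -[s1 vAns 0]/(ev w (EEq (EVar vM) (ENum 1)) s0) ev_eq ev_var s0E.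
have [b rb bP] := run_attempts mL (ltnW nL) candidate_lt nL s1E s1A.
exists b => //; rewrite bP possible_cowinner_tops.
split=> [[/eqP|[z _ [T _ [k2 _ [k3 _]]]]]|[/eqP|[d dc]]]; [by left| |by left|].
  case=> /rank_onto[d ->]; rewrite (inj_eq val_inj) (inj_eq enum_rank_inj) => dc.
  move/good_slotsP => sl /feasible_encode-/(_ dc) pl.
  by right; exists d => //; apply/tops_elect_slots => //; exists T, k2, k3.
move/(tops_elect_slots Q dc) => [T [k2 [k3 [sl pl]]]]; right.
(* The slot conditions bound each guess by the size of a set of voters, so the loops up to the input
   length reach it. *)
have le_n (A : {set 'I_n}) : #|A| < size w.
  by apply: leq_ltn_trans nL; rewrite -[leqRHS]card_ord max_card.
have [_ k2b k3b Tb _] := sl.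
exists (rank d); first exact: leq_trans (ltn_ord _) mL.
exists T; first exact: leq_ltn_trans (leq_trans (leq_addr k2 T) Tb) (le_n _).
exists k2; first exact: leq_ltn_trans k2b (le_n _).
exists k3; first exact: leq_ltn_trans k3b (le_n _).
split=> //; first by rewrite (inj_eq val_inj) (inj_eq enum_rank_inj).
  exact/good_slotsP.
exact/feasible_encode.
Qed.

End Encoding.

Theorem proposition6 :
  polytime_decidable encode_instance
    (fun I : instance =>
       possible_cowinner plurality_runoff (posets I) (candidate I)).
Proof.
exact: polytime_decidable_run decide_fits decide_correct.
Qed.
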